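(* Let $k \subseteq l \subseteq \overline{\mathbb{Q}}$ be algebraic number fields with $e = [l:k]$, and let $\omega_1, \dots, \omega_e \in l$ be a basis of $l$ as a $k$-vector space such that the full $O_k$-module $$\mathfrak M = \{\omega_1\nu_1 + \cdots + \omega_e\nu_e : \nu_i \in O_k\}$$ is contained in $O_l$. Let $\mathcal E_{l/k}(\mathfrak M)$ be the group of relative units of the coefficient ring of $\mathfrak M$ (defined below), and assume that its rank $r(l/k)$ is positive. Let $\varepsilon_1, \varepsilon_2, \dots, \varepsilon_{r(l/k)}$ be multiplicatively independent units in $\mathcal E_{l/k}(\mathfrak M)$. Assume that $\beta \neq 0$ is a point in $O_k$ and $\mu \neq 0$ is a point in $\mathfrak M$ such that $\mathrm{Norm}_{l/k}(\mu) = \zeta\beta$ for some $\zeta \in \mathrm{Tor}(O_k^\times)$. Then there exists $\gamma \in \mathcal E_{l/k}(\mathfrak M)$ such that: - $\gamma\mu \in \mathfrak M$; - $\mathrm{Norm}_{l/k}(\gamma\mu) = \zeta'\beta$ for some $\zeta' \in \mathrm{Tor}(O_k^\times)$; - $$h(\gamma\mu) \le \tfrac12 \sum_{j=1}^{r(l/k)} h(\varepsilon_j) + [l:k]^{-1} h(\beta).$$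
   Context: Notation and conventions. - For a number field $F$, $O_F$ is its ring of integers, $O_F^\times$ its unit group, and $\mathrm{Tor}(O_F^\times)$ the group of roots of unity in $F$. We write $\mathrm{Norm}_{l/k}: l^\times \to k^\times$ for the norm homomorphism. - The coefficient ring of $\mathfrak M$ is $O_{\mathfrak M} = \{\alpha \in l : \alpha\mathfrak M \subseteq \mathfrak M\}$; it is an order in $l$. Its unit group is $O_{\mathfrak M}^\times = O_{\mathfrak M} \cap O_l^\times$. - The group of relative units of the coefficient ring is $$\mathcal E_{l/k}(\mathfrak M) = \{\alpha \in O_{\mathfrak M}^\times : \mathrm{Norm}_{l/k}(\alpha) \in \mathrm{Tor}(O_k^\times)\}.$$ - $r(l)$ and $r(k)$ denote the ranks of $O_l^\times$ and $O_k^\times$, and $r(l/k) = r(l) - r(k)$ is the rank of $\mathcal E_{l/k}(\mathfrak M)$. - Absolute values: for each place $w$ of $l$, let $\|\cdot\|_w$ be the absolute value extending the usual archimedean or $p$-adic absolute value on $\mathbb{Q}$. Set $|\cdot|_w = \|\cdot\|_w^{d_w/d}$, where $d_w = [l_w:\mathbb{Q}_w]$ and $d = [l:\mathbb{Q}]$. - Weil height: for $\alpha \in l^\times$, $$h(\alpha) = \sum_w \log^+|\alpha|_w = \tfrac12 \sum_w \bigl|\log|\alpha|_w\bigr|,$$ where the sums run over all places $w$ of $l$. This quantity does not depend on the choice of number field containing $\alpha$. *)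

(* Defs.v *)
From HB Require Import structures.
From mathcomp Require Import all_boot all_order all_algebra all_field.
From mathcomp Require Import all_classical all_reals all_analysis.

Set Implicit Arguments.
Unset Strict Implicit.
Unset Printing Implicit Defensive.

Import Order.TTheory GRing.Theory Num.Theory.
Import numFieldNormedType.Exports.

Local Open Scope classical_set_scope.
Local Open Scope ring_scope.

Section UnitGroups.
Variable F : fieldType.

Definition ring_of_integers : set F :=
  [set x | integralOver (intr : int -> F) x].

(* [x != 0] is needed because [0^-1 = 0]. *)
Definition integer_units : set F :=
  [set x | [/\ x != 0, ring_of_integers x & ring_of_integers x^-1]].

Definition torsion_units : set F :=
  [set x | integer_units x /\ exists2 n : nat, (0 < n)%N & x ^+ n = 1].

Definition mult_independent (n : nat) (x : 'I_n -> F) : Prop :=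
  forall z : 'I_n -> int, \prod_i x i ^ z i = 1 -> forall i, z i = 0.

Definition has_rank (G : set F) (r : nat) : Prop :=
  (exists2 x : 'I_r -> F, (forall i, G (x i)) & mult_independent x) /\
  (forall (n : nat) (x : 'I_n -> F),
     (forall i, G (x i)) -> mult_independent x -> (n <= r)%N).

(* The value is 0 if [G] has no finite rank; this does not happen for the unit
   group of a number field. *)
Definition mult_rank (G : set F) : nat := xget 0%N [set r | has_rank G r].

Definition unit_rank : nat := mult_rank integer_units.

End UnitGroups.

Arguments ring_of_integers F : clear implicits.
Arguments integer_units F : clear implicits.
Arguments torsion_units F : clear implicits.
Arguments unit_rank F : clear implicits.

Section Places.
Variables (R : realType) (F : fieldType).
Implicit Type w : F -> R.

Definition absolute_value w : Prop :=
  [/\ forall x, 0 <= w x,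
      forall x, w x = 0 <-> x = 0,
      forall x y, w (x * y) = w x * w y
    & forall x y, w (x + y) <= w x + w y].

Definition padic_abs (p : nat) (q : rat) : R :=
  if q == 0 then 0
  else p%:R ^ ((logn p `|denq q|%N)%:Z - (logn p `|numq q|%N)%:Z).

(* Every place of a number field contains exactly one absolute value whose
   restriction to [rat] is the usual archimedean or a normalized p-adic one, so
   a place [w] is represented by this absolute value. *)
Definition places : set (F -> R) :=
  [set w | absolute_value w /\
    ((forall q : rat, w (ratr q) = `|ratr q|) \/
     (exists2 p : nat, prime p &
        forall q : rat, w (ratr q) = padic_abs p q))].

Definition cauchy_at w (u : nat -> F) : Prop :=
  forall eps : R, 0 < eps -> exists N : nat,
    forall m n : nat, (N <= m)%N -> (N <= n)%N -> w (u m - u n) < eps.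

Definition null_at w (u : nat -> F) : Prop :=
  (fun n => w (u n)) @ \oo --> (0 : R).

(* The completion at [w] consists of the [w]-Cauchy sequences modulo the
   [w]-null sequences. [completion_basis w b] says that the classes of
   [b i : nat -> F] form a basis of the completion of [F] over that of [rat]. *)
Definition completion_basis w (n : nat) (b : 'I_n -> nat -> F) : Prop :=
  [/\ forall i, cauchy_at w (b i),
      forall u : nat -> F, cauchy_at w u ->
        exists2 c : 'I_n -> nat -> rat,
          (forall i, cauchy_at w (fun m => ratr (c i m))) &
          null_at w (fun m => u m - \sum_i ratr (c i m) * b i m)
    & forall c : 'I_n -> nat -> rat,
        (forall i, cauchy_at w (fun m => ratr (c i m))) ->
        null_at w (fun m => \sum_i ratr (c i m) * b i m) ->
        forall i, null_at w (fun m => ratr (c i m))].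

Definition local_degree w : nat :=
  xget 0%N [set n | exists b : 'I_n -> nat -> F, completion_basis w b].

End Places.

Arguments places R F : clear implicits.

Section Height.
Variables (R : realType) (F : fieldExtType rat).

Definition normalized_abs (w : F -> R) (x : F) : R :=
  w x `^ ((local_degree w)%:R / (\dim (@fullv rat F))%:R).

Definition log_plus (x : R) : R := Num.max 0 (ln x).

Definition height (x : F) : \bar R :=
  \esum_(w in places R F) (log_plus (normalized_abs w x))%:E.

End Height.

Section RelativeUnits.
Variables (k : fieldExtType rat) (l : fieldExtType k).

Definition field_norm (x : l) : k :=
  \det (passmx.mxof (vbasis (@fullv k l)) (vbasis (@fullv k l)) (amull x)).

Definition integral_span (n : nat) (omega : n.-tuple l) : set l :=
  [set x | exists2 nu : 'I_n -> k,
     (forall i, ring_of_integers k (nu i)) &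
     x = \sum_i nu i *: tnth omega i].

Definition coefficient_ring (M : set l) : set l :=
  [set a | forall x, M x -> M (a * x)].

Definition coefficient_units (M : set l) : set l :=
  coefficient_ring M `&` integer_units l.

Definition relative_units (M : set l) : set l :=
  [set a | coefficient_units M a /\ torsion_units k (field_norm a)].

Definition relative_rank : nat := (unit_rank l - unit_rank k)%N.

End RelativeUnits.

Arguments relative_rank k l : clear implicits.

(* The height of [x : l], with [l] regarded as a finite extension of [rat]. *)
Definition heightl (R : realType) (k : fieldExtType rat) (l : fieldExtType k)
  (x : l) : \bar R := @height R (baseFieldType l) x.
Arguments heightl R {k l} x.

(* Main.v *)
(**
  Index the places by the complex embeddings [s_i] of [l]: every archimedean
  place is some [|s_i|], its local degree is the number of [i] giving it, and an
  integral [x] has height [d^-1 * sum_i max 0 (ln |s_i x|)].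

  Let [L x] be the vector of the [ln |s_i x|].  Then [v = L mu - e^-1 L beta] is
  invariant under complex conjugation and its sum over the embeddings extending a
  given embedding of [k] vanishes.  By Dirichlet's unit theorem the [L eps_j] span
  the space of such vectors: units of [l] come within bounded distance of every
  conjugation-invariant vector of sum zero (pigeonhole), hence span that space;
  multiplicatively independent units have linearly independent logarithms, so that
  unit ranks are dimensions; and the fiber sum maps the span of the logarithms of
  the units of [l] onto a space of dimension at least the unit rank of [k].

  Write [v = sum_j t_j L eps_j], round [t_j] to an integer [m_j], and take
  [gamma = prod_j eps_j ^ (- m_j)]: then [L (gamma mu) - e^-1 L beta] has sum zero
  and coefficients at most 1/2, and only its positive part, half of its l1 norm,
  enters the height.
*)
Require Import Defs.
From HB Require Import structures.
From mathcomp Require Import all_boot all_order all_algebra all_field.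
From mathcomp Require Import all_classical all_reals all_analysis.
From mathcomp Require Import complex ring lra.

Set Implicit Arguments.
Unset Strict Implicit.
Unset Printing Implicit Defensive.

Import Order.TTheory GRing.Theory Num.Theory.
Import numFieldNormedType.Exports.

Local Open Scope classical_set_scope.
Local Open Scope ring_scope.

(** * Embeddings of a finite extension *)

Section PrimitiveElement.
Variables (K : fieldType) (L : fieldExtType K).
Hypothesis pcharL : [pchar L] =i pred0.

(** In characteristic zero every element is separable, so one [th] generates [L]; [p] is its minimal
    polynomial. The last two clauses together present [L] as [K[X]/(p)]. *)
Lemma primitive_element : exists (th : L) (p : {poly K}),
  [/\ size p = (\dim {:L}).+1, separable_poly p, root (map_poly (in_alg L) p) th,
      forall q : {poly K}, root (map_poly (in_alg L) q) th -> p %| q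
    & forall x : L, exists q : {poly K}, x = (map_poly (in_alg L) q).[th]].
Proof.
pose th := separable_generator 1%AS {:L}%AS.
have sepL : separable 1%AS {:L}%AS.
  by apply/allP => x _; apply: pcharf0_separable.
have defL : {:L}%VS = <<1; th>>%VS.
  by rewrite {1}(eq_adjoin_separable_generator sepL (sub1v _)).
have /polyOver1P[p Dp] := minPolyOver 1%AS th.
exists th, p; split.
- rewrite -(size_map_poly (in_alg L)) -Dp size_minPoly defL.
  by rewrite adjoin_degreeE /= dimv1 divn1.
- rewrite -(separable_map (in_alg L)) -Dp.
  exact: (pcharf0_separable 1%AS pcharL th).
- by rewrite -Dp root_minPoly.
- move=> q rq; rewrite -(dvdp_map (in_alg L)) -Dp.
  by apply: minPoly_dvdp rq; apply: alg_polyOver.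
- move=> x; have : x \in <<1; th>>%VS by rewrite -defL memvf.
  by case/Fadjoin1_polyP=> q ->; exists q.
Qed.

End PrimitiveElement.

Section ExtendEmbedding.
Variables (K : fieldType) (L : fieldExtType K) (C : numClosedFieldType).
Variable tau : {rmorphism K -> C}.

Local Notation n := (\dim {:L}).

Lemma pchar_ext0 : [pchar L] =i pred0.
Proof.
move=> p; rewrite (fmorph_pchar (in_alg L)).
by rewrite -(fmorph_pchar tau) pchar_num.
Qed.

Lemma extend_to_root (th : L) (p : {poly K}) (a : C) :
    (forall q : {poly K}, root (map_poly (in_alg L) q) th -> p %| q) ->
    (forall x : L, exists q : {poly K}, x = (map_poly (in_alg L) q).[th]) ->
    root (map_poly tau p) a ->
  exists s : {rmorphism L -> C}, forall q : {poly K},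
    s (map_poly (in_alg L) q).[th] = (map_poly tau q).[a].
Proof.
move=> dvd_p gen_th ra.
have gen_th' x : exists q : {poly K}, x == (map_poly (in_alg L) q).[th].
  by have [q ->] := gen_th x; exists q.
pose P x := xchoose (gen_th' x).
have PE x : (map_poly (in_alg L) (P x)).[th] = x.
  by rewrite -(eqP (xchooseP (gen_th' x))).
pose s x := (map_poly tau (P x)).[a].
have sE q : s (map_poly (in_alg L) q).[th] = (map_poly tau q).[a].
  apply/eqP; rewrite -subr_eq0 -hornerN -hornerD -rmorphB /=.
  have : p %| P (map_poly (in_alg L) q).[th] - q.
    by apply: dvd_p; rewrite /root rmorphB hornerD hornerN PE subrr.
  case/dvdpP => r ->; rewrite rmorphM hornerM.
  by rewrite (eqP (ra : _ == 0)) mulr0.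
have s_add : {morph s : x y / x - y >-> x - y}.
  move=> x y; rewrite -{1}(PE x) -{1}(PE y) -hornerN -hornerD -rmorphB sE.
  by rewrite rmorphB hornerD hornerN.
have s_mul : monoid_morphism s.
  split=> [|x y].
    have -> : 1 = (map_poly (in_alg L) 1%:P).[th] by rewrite rmorph1 hornerC.
    by rewrite sE rmorph1 hornerC.
  by rewrite -{1}(PE x) -{1}(PE y) -hornerM -rmorphM sE rmorphM hornerM.
pose sA := GRing.isZmodMorphism.Build L C s s_add.
pose sM := GRing.isMonoidMorphism.Build L C s s_mul.
pose S : {rmorphism L -> C} := HB.pack s sA sM.
by exists S => q; rewrite -sE.
Qed.

(** The square of the determinant of this matrix is the discriminant of the basis; its invertibility
    expresses the linear independence of the embeddings. *)
Definition embedding_matrix n (s : 'I_n -> L -> C) : 'M[C]_n :=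
  \matrix_(i, j) s j (vbasis {:L})`_i.

(** Embeddings extending [tau] correspond to the roots in [C] of the minimal polynomial of a
    primitive element, which is separable and so has exactly [n] of them. *)
Lemma complete_embeddings : exists s : 'I_n -> {rmorphism L -> C},
  [/\ forall i a, s i a%:A = tau a,
      forall i j, s i =1 s j -> i = j,
      forall r : {rmorphism L -> C}, (forall a, r a%:A = tau a) ->
        exists i, r =1 s i
    & embedding_matrix (fun i => s i : L -> C) \in unitmx].
Proof.
have [th [p [sz_p sep_p rp dvd_p gen_th]]] := primitive_element pchar_ext0.
have [rs Drs] := closed_field_poly_normal (map_poly tau p).
have pn0 : map_poly tau p != 0.
  by rewrite map_poly_eq0 -size_poly_eq0 sz_p.
have sep_tp : separable_poly (map_poly tau p) by rewrite separable_map.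
have uniq_rs : uniq rs.
  rewrite -(separable_prod_XsubC rs).
  have lc0 : lead_coef (map_poly tau p) != 0 by rewrite lead_coef_eq0.
  by rewrite -(eqp_separable (eqp_scale _ lc0)) -Drs.
have sz_rs : size rs = n.
  have : size (map_poly tau p) = n.+1 by rewrite size_map_poly.
  rewrite Drs size_scale ?lead_coef_eq0 // size_prod_XsubC.
  by case.
have mem_rs a : (a \in rs) = root (map_poly tau p) a.
  by rewrite [in RHS]Drs rootZ ?lead_coef_eq0 // root_prod_XsubC.
have ex_s (i : 'I_n) : exists s : {rmorphism L -> C}, forall q : {poly K},
    s (map_poly (in_alg L) q).[th] = (map_poly tau q).[rs`_i].
  apply: extend_to_root dvd_p gen_th _.
  by rewrite -mem_rs mem_nth // sz_rs.
have {ex_s}[s sE] : exists s : 'I_n -> {rmorphism L -> C},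
    forall i (q : {poly K}),
      s i (map_poly (in_alg L) q).[th] = (map_poly tau q).[rs`_i].
  by case: (boolp.choice ex_s) => s sE; exists s.
have s_th i : s i th = rs`_i.
  by have := sE i 'X; rewrite !map_polyX !hornerX.
have s_base i a : s i a%:A = tau a.
  by have := sE i a%:P; rewrite !map_polyC !hornerC.
exists s; split=> //.
- move=> i j eq_s; apply/val_inj/eqP.
  by rewrite /= -(nth_uniq 0 _ _ uniq_rs) ?sz_rs // -!s_th eq_s.
- move=> r r_base.
  have rE q : r (map_poly (in_alg L) q).[th] = (map_poly tau q).[r th].
    rewrite -horner_map -map_poly_comp; congr (_.[_]).
    by apply: eq_map_poly => a; apply: r_base.
  have : r th \in rs by rewrite mem_rs /root -rE (eqP (rp : _ == 0)) rmorph0.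
  case/(nthP 0) => i; rewrite sz_rs => lt_i Di.
  by exists (Ordinal lt_i) => x; have [q ->] := gen_th x; rewrite sE rE Di.
(* A linear relation between the columns is a relation between the embeddings on all of [L]; on the
   powers of [th] it becomes a relation for the Vandermonde matrix of the distinct roots. *)
- rewrite -unitmx_tr -row_free_unit; apply/inj_row_free => v v0.
  pose V := Vandermonde n (\row_(i < n) rs`_i).
  have V_unit : V^T \in unitmx.
    rewrite unitmx_tr unitmxE det_Vandermonde unitfE.
    apply/prodf_neq0 => i _; apply/prodf_neq0 => j lt_ij.
    by rewrite !mxE subr_eq0 nth_uniq ?sz_rs // neq_ltn lt_ij orbT.
  have vs0 x : \sum_i v 0 i * s i x = 0.
    rewrite (coord_vbasis (memvf x)).
    under eq_bigr => i _ do rewrite rmorph_sum mulr_sumr.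
    rewrite exchange_big big1 //= => j _.
    under eq_bigr => i _ do rewrite -mulr_algl rmorphM s_base mulrCA.
    rewrite -mulr_sumr; have /matrixP/(_ 0 j) := v0; rewrite !mxE.
    under eq_bigr => i _ do rewrite !mxE.
    by move=> ->; rewrite mulr0.
  suff : v *m V^T = 0 by move/(canRL (mulmxK V_unit)); rewrite mul0mx.
  apply/rowP=> j; rewrite !mxE -[RHS](vs0 (th ^+ j)).
  by apply: eq_bigr => i _; rewrite !mxE rmorphXn /= s_th.
Qed.

(** Each column of the embedding matrix is an eigenvector of multiplication by [x], with eigenvalue
    [s i x]. Taking determinants and traces then gives the norm and the trace as product and sum of
    conjugates. *)
Lemma mulmx_embedding_matrix (s : 'I_n -> {rmorphism L -> C}) x :
    (forall i a, s i a%:A = tau a) ->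
  let e := vbasis {:L} in
  map_mx tau (passmx.mxof e e (amull x)) *m embedding_matrix (fun i => s i : L -> C)
  = embedding_matrix (fun i => s i : L -> C) *m diag_mx (\row_i s i x).
Proof.
move=> s_base e; apply/matrixP => i j; rewrite mul_mx_diag !mxE.
rewrite mulrC -rmorphM /=.
have -> : x * e`_i = \sum_m passmx.mxof e e (amull x) i m *: e`_m.
  rewrite [LHS](coord_vbasis (memvf _)); apply: eq_bigr => m _; congr (_ *: _).
  by rewrite mxE /= passmx.vecof_delta mxE lfunE.
rewrite rmorph_sum; apply: eq_bigr => m _.
by rewrite -mulr_algl rmorphM s_base !mxE.
Qed.

Lemma det_embeddings (s : 'I_n -> {rmorphism L -> C}) x :
    (forall i a, s i a%:A = tau a) ->
    embedding_matrix (fun i => s i : L -> C) \in unitmx ->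
  tau (\det (passmx.mxof (vbasis {:L}) (vbasis {:L}) (amull x))) = \prod_i s i x.
Proof.
move=> s_base uB; have := congr1 determinant (mulmx_embedding_matrix x s_base).
rewrite !det_mulmx mulrC; move: uB; rewrite unitmxE => uB.
move/(mulrI uB); rewrite det_map_mx => ->; rewrite det_diag.
by apply: eq_bigr => i _; rewrite mxE.
Qed.

Lemma trace_embeddings (s : 'I_n -> {rmorphism L -> C}) x :
    (forall i a, s i a%:A = tau a) ->
    embedding_matrix (fun i => s i : L -> C) \in unitmx ->
  tau (\tr (passmx.mxof (vbasis {:L}) (vbasis {:L}) (amull x))) = \sum_i s i x.
Proof.
move=> s_base uB; rewrite -trace_map_mx.
rewrite (canRL (mulmxK uB) (mulmx_embedding_matrix x s_base)).
rewrite mxtrace_mulC mulmxA mulVmx // mul1mx mxtrace_diag.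
by apply: eq_bigr => i _; rewrite mxE.
Qed.

End ExtendEmbedding.

(** * Complex absolute value and algebraic integers *)

Section ComplexAbs.
Variable R : realType.
Implicit Types z : R[i].

(** The norm of [R[i]] takes its values in [R[i]]; logarithms and places need this real-valued
    version. *)
Definition cabs z : R := Normc.normc z.

Lemma cabsE z : `|z| = (cabs z)%:C%C. Proof. by []. Qed.

Lemma cabs_ge0 z : 0 <= cabs z.
Proof. by have := normr_ge0 z; rewrite cabsE ler0c. Qed.

Lemma cabs0 : cabs 0 = 0. Proof. exact: Normc.normc0. Qed.
Lemma cabs1 : cabs 1 = 1. Proof. exact: Normc.normc1. Qed.
Lemma cabsM x y : cabs (x * y) = cabs x * cabs y. Proof. exact: Normc.normcM. Qed.
Lemma cabsV x : cabs x^-1 = (cabs x)^-1. Proof. exact: Normc.normcV. Qed.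

Lemma cabs_eq0 z : (cabs z == 0) = (z == 0).
Proof. by apply/eqP/eqP => [/Normc.eq0_normc|->]; rewrite ?cabs0. Qed.

Lemma cabs_gt0 z : (0 < cabs z) = (z != 0).
Proof. by rewrite lt0r cabs_eq0 cabs_ge0 andbT. Qed.

Lemma cabsD x y : cabs (x + y) <= cabs x + cabs y. Proof. exact: le_normcD. Qed.

Lemma cabsX x n : cabs (x ^+ n) = cabs x ^+ n.
Proof. by elim: n => [|n IHn]; rewrite ?cabs1 // !exprS cabsM IHn. Qed.

Lemma cabs_sum (I : Type) (r : seq I) (P : pred I) (f : I -> R[i]) :
  cabs (\sum_(i <- r | P i) f i) <= \sum_(i <- r | P i) cabs (f i).
Proof.
elim/big_rec2: _ => [|i y z _ le_zy]; first by rewrite cabs0.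
by rewrite (le_trans (cabsD _ _)) // lerD2l.
Qed.

Lemma cabs_prod (I : Type) (r : seq I) (P : pred I) (f : I -> R[i]) :
  cabs (\prod_(i <- r | P i) f i) = \prod_(i <- r | P i) cabs (f i).
Proof. by apply: (big_morph _ cabsM cabs1). Qed.

Lemma cabs_real (x : R) : cabs x%:C%C = `|x|.
Proof. by rewrite /cabs /= expr0n /= addr0 sqrtr_sqr. Qed.

Lemma cabs_rat (q : rat) : cabs (ratr q) = `|ratr q|.
Proof. by rewrite -(fmorph_rat (real_complex R)) cabs_real. Qed.

Lemma cabs_int (m : int) : cabs m%:~R = `|m%:~R|.
Proof. by rewrite -(ratr_int R[i]%type) -(ratr_int R) cabs_rat. Qed.

Lemma cabs_conj z : cabs (conjc z) = cabs z.
Proof. by case: z => a b; rewrite /cabs /= sqrrN. Qed.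

Lemma cabs_sqr z : cabs z ^+ 2 = complex.Re z ^+ 2 + complex.Im z ^+ 2.
Proof. by case: z => a b; rewrite sqr_sqrtr // addr_ge0 ?sqr_ge0. Qed.

Lemma le_Re_cabs z : `|complex.Re z| <= cabs z.
Proof.
rewrite -(@ler_pXn2r _ 2) ?nnegrE ?cabs_ge0 //.
by rewrite real_normK ?num_real // cabs_sqr lerDl sqr_ge0.
Qed.

Lemma le_Im_cabs z : `|complex.Im z| <= cabs z.
Proof.
rewrite -(@ler_pXn2r _ 2) ?nnegrE ?cabs_ge0 //.
by rewrite real_normK ?num_real // cabs_sqr lerDr sqr_ge0.
Qed.

Lemma cabs_le_ReIm z : cabs z <= `|complex.Re z| + `|complex.Im z|.
Proof.
rewrite -(@ler_pXn2r _ 2) ?nnegrE ?cabs_ge0 ?addr_ge0 //.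
rewrite cabs_sqr sqrrD !real_normK ?num_real // -addrA lerD2l lerDr.
by rewrite mulrn_wge0 // mulr_ge0.
Qed.

Lemma ln_prod (I : Type) (r : seq I) (P : pred I) (f : I -> R) :
    (forall i, 0 < f i) ->
  ln (\prod_(i <- r | P i) f i) = \sum_(i <- r | P i) ln (f i).
Proof.
move=> f_gt0; suff [] : 0 < \prod_(i <- r | P i) f i /\
  ln (\prod_(i <- r | P i) f i) = \sum_(i <- r | P i) ln (f i) by [].
elim/big_rec2: _ => [|i y z _ [z_gt0 <-]]; first by rewrite ltr01 ln1.
by rewrite mulr_gt0 // lnM ?posrE.
Qed.

End ComplexAbs.

Section Integers.
Implicit Type F : fieldType.

Let toF F : {rmorphism int -> F} := intr.

Lemma intring0 F : ring_of_integers F 0. Proof. exact: (mxpoly.integral0 (toF F)). Qed.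
Lemma intring1 F : ring_of_integers F 1. Proof. exact: (mxpoly.integral1 (toF F)). Qed.

Lemma intring_int F (m : int) : ring_of_integers F m%:~R.
Proof. exact: (mxpoly.integral_id (toF F)). Qed.

Lemma intringD F (x y : F) :
  ring_of_integers F x -> ring_of_integers F y -> ring_of_integers F (x + y).
Proof. exact: (@mxpoly.integral_add _ _ (toF F)). Qed.

Lemma intringM F (x y : F) :
  ring_of_integers F x -> ring_of_integers F y -> ring_of_integers F (x * y).
Proof. exact: (@mxpoly.integral_mul _ _ (toF F)). Qed.

Lemma intring_sum F (I : Type) (r : seq I) (P : pred I) (f : I -> F) :
    (forall i, P i -> ring_of_integers F (f i)) ->
  ring_of_integers F (\sum_(i <- r | P i) f i).
Proof. by move=> fP; elim/big_ind: _ => //; [exact: intring0 | exact: intringD]. Qed.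

Lemma intring_prod F (I : Type) (r : seq I) (P : pred I) (f : I -> F) :
    (forall i, P i -> ring_of_integers F (f i)) ->
  ring_of_integers F (\prod_(i <- r | P i) f i).
Proof. by move=> fP; elim/big_ind: _ => //; [exact: intring1 | exact: intringM]. Qed.

Lemma map_poly_intr (A B : nzRingType) (f : {rmorphism A -> B}) (p : {poly int}) :
  map_poly f (map_poly intr p) = map_poly intr p.
Proof. by rewrite -map_poly_comp; apply: eq_map_poly => m /=; rewrite rmorph_int. Qed.

Lemma intring_morph (F C : fieldType) (f : {rmorphism F -> C}) x :
  ring_of_integers C (f x) <-> ring_of_integers F x.
Proof.
split=> -[p mon_p rp]; exists p => //.
  by move: rp; rewrite -(map_poly_intr f) fmorph_root.
by rewrite -(map_poly_intr f) fmorph_root.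
Qed.

Lemma intring_rat (q : rat) : ring_of_integers rat q -> exists m : int, q = m%:~R.
Proof.
case=> p mon_p rp.
have [m Dm] : exists m : int, (ratr q : algC) = m%:~R.
  apply/intrP/Cint_rat_Aint; first exact: Crat_rat.
  apply: (@root_monic_Aint (map_poly intr p)).
  - by rewrite -(map_poly_intr (@ratr algC)) fmorph_root.
  - exact: monic_map.
  - by apply/polyOverP => i; rewrite coef_map /= intr_int.
by exists m; apply: (fmorph_inj (@ratr algC)); rewrite /= Dm ratr_int.
Qed.

(** Clear denominators in an equation of [x] and multiply [x] by the leading coefficient. *)
Lemma integral_multiple (F : fieldExtType rat) (x : F) :
  exists2 m : int, m != 0 & ring_of_integers F (m%:~R * x).
Proof.
have [p p_n0 rp] : algebraicOver (in_alg F) x.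
  have /polyOver1P[q Dq] := minPolyOver 1%AS x.
  exists q; rewrite -?Dq ?root_minPoly // -(map_poly_eq0 (in_alg F)) -Dq.
  by rewrite monic_neq0 // monic_minPoly.
have [q [a a_n0 Dp]] := rat_poly_scale p.
have intF_inj : injective (intr : int -> F).
  by move=> m m' /eqP; rewrite -!(rmorph_int (in_alg F)) fmorph_eq => /eqP/intr_inj.
have rq : root (map_poly (intr : int -> F) q) x.
  move: rp; rewrite Dp map_polyZ rootZ ?map_poly_intr //.
  by rewrite fmorph_eq0 invr_eq0 intr_eq0.
have q_n0 : q != 0.
  by apply: contraNneq p_n0 => q0; rewrite Dp q0 rmorph0 scaler0.
have [n Dn] : exists n, size q = n.+2.
  have := root_size_gt1 _ rq; rewrite -size_poly_eq0 size_map_inj_poly ?mulr0z //.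
  rewrite size_poly_eq0 => /(_ q_n0).
  by case: (size q) => [|[|n]] // _; exists n.
pose c := lead_coef q; exists c; first by rewrite lead_coef_eq0.
(* This is [c^n q(X/c)], where [q] has degree [n+1] and leading coefficient [c]: it is monic and
   vanishes at [c x]. *)
pose r : {poly int} := 'X^(n.+1) + \poly_(i < n.+1) (q`_i * c ^+ (n - i)).
exists r.
  rewrite /r monicE lead_coefDl ?lead_coefXn // size_polyXn.
  exact: leq_ltn_trans (size_poly _ _) _.
have -> : map_poly intr r =
    'X^(n.+1) + \poly_(i < n.+1) ((q`_i)%:~R * c%:~R ^+ (n - i)) :> {poly F}.
  apply/polyP => i; rewrite coef_map /= !coefD !coefXn !coef_poly rmorphD /=.
  by rewrite rmorph_nat; case: ifP => _; rewrite ?intrM ?rmorphXn ?mulr0z.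
rewrite /root hornerD hornerXn horner_poly.
have := rq; rewrite /root horner_coef size_map_inj_poly ?mulr0z // Dn.
rewrite big_ord_recr /= coef_map /=.
rewrite -[q`_n.+1]/(q`_(n.+2.-1)) -Dn -/(lead_coef q) -/c addrC => /eqP rq0.
apply/eqP; transitivity ((c%:~R : F) ^+ n *
    (c%:~R * x ^+ n.+1 + \sum_(i < n.+1) (map_poly intr q)`_i * x ^+ i)).
  rewrite mulrDr mulr_sumr exprMn mulrA -exprSr; congr (_ + _).
  apply: eq_bigr => i _; rewrite coef_map /= exprMn.
  have le_in : (i <= n)%N by rewrite -ltnS.
  have -> : (c%:~R : F) ^+ n = c%:~R ^+ (n - i) * c%:~R ^+ i.
    by rewrite -exprD subnK.
  by ring.
by rewrite rq0 mulr0.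
Qed.

End Integers.

(** * Traces, norms and bounded integers of a number field *)

Definition full_embeddings (R : realType) (F : fieldExtType rat)
    (s : 'I_(\dim {:F}) -> {rmorphism F -> R[i]}) : Prop :=
  [/\ forall i j, s i =1 s j -> i = j,
      forall r : {rmorphism F -> R[i]}, exists i, r =1 s i
    & embedding_matrix (fun i => s i : F -> R[i]) \in unitmx].

Lemma full_embeddings_exist (R : realType) (F : fieldExtType rat) :
  exists s, @full_embeddings R F s.
Proof.
have [s [_ s_inj s_full s_unit]] := complete_embeddings F (@ratr R[i]).
exists s; split=> // r; apply: s_full => a.
by rewrite alg_num_field fmorph_rat.
Qed.

Section NumberField.
Variables (R : realType) (F : fieldExtType rat).
Local Notation n := (\dim {:F}).
Variable s : 'I_n -> {rmorphism F -> R[i]}.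
Hypothesis sP : full_embeddings s.

Lemma embedding_alg i a : s i a%:A = ratr a.
Proof. by rewrite alg_num_field fmorph_rat. Qed.

Let s_unit : embedding_matrix (fun i => s i : F -> R[i]) \in unitmx.
Proof. by case: sP. Qed.

Lemma dim_field_gt0 : (0 < n)%N.
Proof. exact: adim_gt0. Qed.

Lemma conj_index : exists c : 'I_n -> 'I_n,
  forall i x, s (c i) x = conjc (s i x).
Proof.
have [_ s_full _] := sP.
have ex_c i : exists j, (@conjc R \o s i : F -> R[i]) =1 s j by apply: (s_full _).
have [c cP] := boolp.choice ex_c.
by exists c => i x; rewrite -cP.
Qed.

Lemma intring_ratr_int (q : rat) :
  ring_of_integers R[i] (ratr q) -> exists m : int, q = m%:~R.
Proof. by move/(intring_morph (@ratr R[i])); apply: intring_rat. Qed.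

(** The trace is rational as the trace of a rational matrix and integral as a sum of conjugates,
    hence an integer. *)
Lemma trace_int x : ring_of_integers F x -> exists m : int, \sum_i s i x = m%:~R.
Proof.
move=> xP; have tr := trace_embeddings x embedding_alg s_unit.
have [|m Dm] := @intring_ratr_int
    (\tr (passmx.mxof (vbasis {:F}) (vbasis {:F}) (amull x))).
  by rewrite tr; apply: intring_sum => i _; apply/intring_morph.
by exists m; rewrite -tr Dm /= ratr_int.
Qed.

Lemma norm_int x : ring_of_integers F x -> exists m : int, \prod_i s i x = m%:~R.
Proof.
move=> xP; have tr := det_embeddings x embedding_alg s_unit.
have [|m Dm] := @intring_ratr_int
    (\det (passmx.mxof (vbasis {:F}) (vbasis {:F}) (amull x))).
  by rewrite tr; apply: intring_prod => i _; apply/intring_morph.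
by exists m; rewrite -tr Dm /= ratr_int.
Qed.

Lemma embedding_cabs_gt0 i x : x != 0 -> 0 < cabs (s i x).
Proof. by rewrite cabs_gt0 fmorph_eq0. Qed.

Lemma norm_abs_nat x : x != 0 -> ring_of_integers F x ->
  exists2 m : nat, (0 < m)%N & \prod_i cabs (s i x) = m%:R.
Proof.
move=> x0 /norm_int[m Dm]; have Dabs : \prod_i cabs (s i x) = `|m|%N%:R.
  by rewrite -cabs_prod Dm cabs_int -intr_norm natr_absz.
exists `|m|%N => //; rewrite -(ltr_nat R) -Dabs.
by apply: prodr_gt0 => i _; apply: embedding_cabs_gt0.
Qed.

Lemma unit_norm x : integer_units F x -> \prod_i cabs (s i x) = 1.
Proof.
case=> x0 xI xVI; have [m m_gt0 Dm] := norm_abs_nat x0 xI.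
have xV0 : x^-1 != 0 by rewrite invr_eq0.
have [m' m'_gt0 Dm'] := norm_abs_nat xV0 xVI.
have : (m * m')%:R = 1 :> R.
  rewrite natrM -Dm -Dm' -big_split big1 //= => i _.
  by rewrite -cabsM -rmorphM mulfV // rmorph1 cabs1.
by move/eqP; rewrite pnatr_eq1 muln_eq1 Dm => /andP[/eqP->].
Qed.

Lemma sum_ln_unit x : integer_units F x -> \sum_i ln (cabs (s i x)) = 0.
Proof.
move=> xU; rewrite -ln_prod ?unit_norm ?ln1 // => i.
by case: xU => x0 _ _; apply: embedding_cabs_gt0.
Qed.

Lemma embedding_eq_vec (v : 'I_n -> R[i]) (d : 'I_n -> rat) :
    (forall j, d j != 0) ->
    (forall j, \sum_i v i * s i (ratr (d j) * (vbasis {:F})`_j) = 0) ->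
  forall i, v i = 0.
Proof.
move=> d0 v0.
have : (\row_i v i) *m (embedding_matrix (fun i => s i : F -> R[i]))^T = 0.
  apply/rowP => j; rewrite !mxE; apply: (mulfI (_ : ratr (d j) != 0)).
    by rewrite fmorph_eq0.
  rewrite mulr0 -[RHS](v0 j) mulr_sumr; apply: eq_bigr => i _.
  by rewrite !mxE rmorphM fmorph_rat mulrCA.
have uT := s_unit; rewrite -unitmx_tr in uT.
move/(canRL (mulmxK uT)); rewrite mul0mx => /rowP v0' i.
by have := v0' i; rewrite !mxE.
Qed.

Lemma integral_basis : exists b : 'I_n -> F,
  [/\ forall j, ring_of_integers F (b j),
      forall v : 'I_n -> R[i], (forall j, \sum_i v i * s i (b j) = 0) ->
        forall i, v i = 0
    & forall z : 'I_n -> int, \sum_j (z j)%:~R * b j = 0 -> forall j, z j = 0].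
Proof.
have /boolp.choice[d dP] : forall j : 'I_n, exists m : int,
    m != 0 /\ ring_of_integers F (m%:~R * (vbasis {:F})`_j).
  by move=> j; have [m] := integral_multiple (vbasis {:F})`_j; exists m.
exists (fun j => (d j)%:~R * (vbasis {:F})`_j); split.
- by move=> j; case: (dP j).
- move=> v v0; apply: (@embedding_eq_vec v (fun j => (d j)%:~R)).
    by move=> j; rewrite intr_eq0; case: (dP j).
  by move=> j; rewrite ratr_int.
- move=> z z0 j; have /freeP := basis_free (vbasisP {:F}).
  have z0' : \sum_j ((z j * d j)%:~R : rat) *: (vbasis {:F})`_j = 0.
    rewrite -[RHS]z0; apply: eq_bigr => i _.
    by rewrite -mulr_algl alg_num_field ratr_int intrM mulrA.
  move/(_ _ z0' j)/eqP; rewrite intr_eq0 mulf_eq0; case: (dP j) => /negPf-> _.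
  by rewrite orbF => /eqP.
Qed.

(* An integer is determined by its traces against an integral basis. *)
Lemma bounded_integers_finite (B : R) : exists N : nat,
  forall g : 'I_N -> F, (forall m, ring_of_integers F (g m)) ->
    (forall m i, cabs (s i (g m)) <= B) -> ~ injective g.
Proof.
have [b [b_int b_det _]] := integral_basis.
pose A := \sum_j \sum_i `|B| * cabs (s i (b j)).
pose T := Num.bound A.
have A_ge0 : 0 <= A.
  by apply: sumr_ge0 => j _; apply: sumr_ge0 => i _; rewrite mulr_ge0 ?cabs_ge0.
(* Each trace is an integer between [-T] and [T]; shifted by [T] it fits in ['I_(T + T).+1]. One
   element more than there are keys forces a coincidence. *)
pose key := {ffun 'I_n -> 'I_(T + T).+1}.
exists #|{: key}|.+1 => g g_int g_bd g_inj.
have ex_t m : exists t : 'I_n -> int, forall j, \sum_i s i (g m * b j) = (t j)%:~R.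
  have /boolp.choice[t tP] : forall j, exists t : int, \sum_i s i (g m * b j) = t%:~R.
    by move=> j; apply: trace_int; apply: intringM.
  by exists t.
have {ex_t}[t tP] := boolp.choice ex_t.
have t_bd m j : `|t m j| <= T%:Z.
  rewrite -(ler_int R) intr_norm -cabs_int -tP.
  rewrite (le_trans (cabs_sum _ _ _)) // ltW // (le_lt_trans _ (archi_boundP A_ge0)) //.
  rewrite /A [leRHS](bigD1 j) //= ler_wpDr //.
    by apply: sumr_ge0 => j' _; apply: sumr_ge0 => i _; rewrite mulr_ge0 ?cabs_ge0.
  apply: ler_sum => i _; rewrite rmorphM cabsM ler_wpM2r ?cabs_ge0 //.
  exact: le_trans (g_bd _ _) (ler_norm _).
pose k m : key := [ffun j => inord (absz (t m j + T%:Z))].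
have k_inj : injective k.
  move=> m m' /ffunP eq_k; apply: g_inj.
  apply: (fmorph_inj (s (Ordinal dim_field_gt0))).
  apply/eqP; rewrite -subr_eq0; apply/eqP.
  apply: (b_det (fun i => s i (g m) - s i (g m'))) => j.
  under eq_bigr => i _ do rewrite mulrBl -!rmorphM.
  rewrite sumrB !tP; apply/eqP; rewrite subr_eq0 eqr_int; apply/eqP.
  have t_range a : (absz (t a j + T%:Z))%:Z = t a j + T%:Z /\
      (absz (t a j + T%:Z)%R < (T + T).+1)%N.
    have := t_bd a j; rewrite ler_norml => /andP[lo hi]; split.
      by rewrite gez0_abs // -lerBlDr sub0r.
    rewrite ltnS -lez_nat gez0_abs ?PoszD ?lerD2r //.
    by rewrite -lerBlDr sub0r.
  have [e1 l1] := t_range m; have [e2 l2] := t_range m'.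
  have := eq_k j; rewrite !ffunE => /(congr1 val) /=; rewrite !inordK // => E.
  by apply: (addIr T%:Z); rewrite -e1 -e2 E.
by have := leq_card k k_inj; rewrite card_ord ltnn.
Qed.

End NumberField.

(** * Local degrees *)

Section RealSequences.
Variable R : realType.
Implicit Types u v : nat -> R.

Lemma real_cauchy_cvg u :
    (forall e : R, 0 < e -> exists N : nat, forall m n : nat,
       (N <= m)%N -> (N <= n)%N -> `|u m - u n| < e) ->
  exists l : R, u @ \oo --> l.
Proof.
move=> uC; suff : cvg (u @ \oo) by exists (lim (u @ \oo)).
apply/cauchy_cvgP/cauchyP => e e0; have [N NP] := uC e e0.
exists (u N); exists N => // n le_Nn.
by rewrite /= /ball /= NP.
Qed.

Lemma real_cvg_cauchy u (l : R) : u @ \oo --> l ->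
  forall e : R, 0 < e -> exists N : nat, forall m n : nat,
    (N <= m)%N -> (N <= n)%N -> `|u m - u n| < e.
Proof.
move=> /cvgrPdist_lt ul e e0; have e2 : 0 < e / 2 by rewrite divr_gt0.
have [N _ NP] := ul _ e2; exists N => m n /NP/= lm /NP/= ln.
have -> : u m - u n = (l - u n) - (l - u m) by ring.
by rewrite (le_lt_trans (ler_normB _ _)) // [e]splitr ltrD.
Qed.

Lemma cvg_sub0 u v (l : R) : u @ \oo --> l ->
  (fun n => u n - v n) @ \oo --> (0 : R) -> v @ \oo --> l.
Proof.
move=> ul uv; have -> : v = (fun n => u n - (u n - v n)).
  by apply/funext => n; rewrite opprB addrC subrK.
by rewrite -[l]subr0; apply: cvgB.
Qed.

Lemma cvg0_le u v : (forall n, `|u n| <= v n) ->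
  v @ \oo --> (0 : R) -> u @ \oo --> (0 : R).
Proof.
move=> le_uv v0; apply: norm_cvg0; apply: squeeze_cvgr v0; last exact: cvg_cst.
by near=> n; rewrite normr_ge0 le_uv.
Unshelve. all: by end_near.
Qed.

Lemma cvgMl0 (a : R) u : u @ \oo --> (0 : R) -> (fun n => a * u n) @ \oo --> (0 : R).
Proof.
by move=> u0; rewrite -(mulr0 a); apply: cvgM => //; exact: cvg_cst.
Qed.

Lemma cvg_sumr (m : nat) (u : 'I_m -> nat -> R) (l : 'I_m -> R) :
  (forall i, u i @ \oo --> l i) ->
  (fun n => \sum_i u i n) @ \oo --> \sum_i l i.
Proof. by move=> ul; apply: cvg_big => //; exact: add_continuous. Qed.

(** Represents real coefficients by sequences of rationals, as the completion of [rat] requires. *)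
Lemma rat_approx u : exists c : nat -> rat,
  (fun n => u n - ratr (c n)) @ \oo --> (0 : R).
Proof.
have ex_c n : exists c : rat, `|u n - ratr c| <= n.+1%:R^-1.
  have [|q] := @rat_in_itvoo R (u n - n.+1%:R^-1) (u n); first by rewrite gtrBl.
  rewrite in_itv /= => /andP[lo hi]; exists q.
  rewrite ger0_norm ?subr_ge0; last exact: ltW.
  by rewrite lerBlDl -lerBlDr ltW.
have [c cP] := boolp.choice ex_c.
exists c; apply: (cvg0_le cP); exact: cvg_harmonic.
Qed.

End RealSequences.

Section LocalDegree.
Variables (R : realType) (F : fieldType) (w : F -> R) (m : nat).
Variables (phi : F -> 'I_m -> R) (e : 'I_m -> F) (K : R).
Hypothesis w_ge0 : forall x, 0 <= w x.
Hypothesis w_rat : forall q : rat, w (ratr q) = `|ratr q|.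
Hypothesis ratB : forall p q : rat, ratr (p - q) = ratr p - ratr q :> F.
Hypothesis phiB : forall x y i, phi (x - y) i = phi x i - phi y i.
Hypothesis phi_rat : forall (q : rat) x i, phi (ratr q * x) i = ratr q * phi x i.
Hypothesis phi_le : forall x i, `|phi x i| <= K * w x.
Hypothesis w_le : forall x, w x <= K * \sum_i `|phi x i|.
Hypothesis phi_e : forall i j, phi (e j) i = (i == j)%:R.
Hypothesis K_gt0 : 0 < K.

Let phi0 i : phi 0 i = 0.
Proof. by rewrite -(subr0 0) phiB subrr. Qed.

Let phiD x y i : phi (x + y) i = phi x i + phi y i.
Proof.
have -> : x + y = x - (0 - y) by rewrite sub0r opprK.
by rewrite !phiB phi0 sub0r opprK.
Qed.

Let phi_sum n (f : 'I_n -> F) i : phi (\sum_j f j) i = \sum_j phi (f j) i.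
Proof. by rewrite (big_morph (phi^~ i) (fun x y => phiD x y i) (phi0 i)). Qed.

Let null_phi u : null_at w u <-> forall i, (fun n => phi (u n) i) @ \oo --> (0 : R).
Proof.
split=> [u0 i|u0].
  apply: (@cvg0_le R _ (fun n => K * w (u n))) => //.
  exact: cvgMl0.
apply: (@cvg0_le R _ (fun n => K * \sum_i `|phi (u n) i|)) => [n|].
  by rewrite ger0_norm.
apply: cvgMl0.
have : (fun n => \sum_i `|phi (u n) i|) @ \oo --> \sum_(i < m) `|0 : R|.
  by apply: (@cvg_sumr _ _ (fun i n => `|phi (u n) i|)) => i; apply: cvg_norm.
have -> : \sum_(i < m) `|0 : R| = 0 by rewrite big1 // => i _; rewrite normr0.
by [].
Qed.

Let cauchy_phi u : cauchy_at w u -> forall i, exists l : R,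
  (fun n => phi (u n) i) @ \oo --> l.
Proof.
move=> uC i; apply: real_cauchy_cvg => d d0.
have dK : 0 < d / K by rewrite divr_gt0.
have [N NP] := uC _ dK; exists N => p q lp lq; rewrite -phiB.
by rewrite (le_lt_trans (phi_le _ _)) // mulrC -ltr_pdivlMr // NP.
Qed.

Let cauchy_rat (c : nat -> rat) : cauchy_at w (fun n => ratr (c n)) <->
  exists l : R, (fun n => ratr (c n) : R) @ \oo --> l.
Proof.
split=> [cC|[l cl]].
  apply: real_cauchy_cvg => d d0; have [N NP] := cC d d0; exists N => p q lp lq.
  by have := NP p q lp lq; rewrite -ratB w_rat rmorphB.
move=> d d0; have [N NP] := real_cvg_cauchy cl d0; exists N => p q lp lq.
by have := NP p q lp lq; rewrite -ratB w_rat rmorphB.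
Qed.

Let null_rat (c : nat -> rat) : null_at w (fun n => ratr (c n)) <->
  (fun n => ratr (c n) : R) @ \oo --> (0 : R).
Proof.
split=> c0.
  by apply: cvg0_le c0 => n; rewrite w_rat.
by apply: (@cvg0_le R _ (fun n => `|ratr (c n)|)) => [n|];
   rewrite ?w_rat ?normr_id // -[0](@normr0 R R); exact: cvg_norm.
Qed.

Let coord_basis : completion_basis w (fun i (_ : nat) => e i).
Proof.
have phi_lin (c : 'I_m -> nat -> rat) n i :
    phi (\sum_j ratr (c j n) * e j) i = ratr (c i n).
  rewrite phi_sum (bigD1 i) //= phi_rat phi_e eqxx mulr1 big1 ?addr0 // => j ij.
  by rewrite phi_rat phi_e eq_sym (negPf ij) mulr0.
split=> [i d d0|u uC|c cC c0 i].
- exists 0%N => p q _ _; rewrite subrr -(subrr (ratr 0)) -ratB w_rat subrr.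
  by rewrite rmorph0 normr0.
- have /boolp.choice[l lP] := cauchy_phi uC.
  have /boolp.choice[c cP] := fun i => rat_approx (fun n => phi (u n) i).
  exists c => [i|].
    by apply/cauchy_rat; exists (l i); apply: cvg_sub0 (lP i) (cP i).
  apply/null_phi => i.
  rewrite (_ : (fun n => _) = (fun n => phi (u n) i - ratr (c i n))) //.
  by apply/funext => n; rewrite phiB phi_lin.
- apply/null_rat; have /null_phi/(_ i) := c0.
  by under [X in X @ _]boolp.eq_fun do rewrite phi_lin.
Qed.

(** The limits of the coordinates of the [b i] form a real [n] by [m] matrix [B]. Independence of
    the classes makes its rows independent, so [n <= m]; spanning the constant sequences [e j] gives
    it a left inverse, so [m <= n]. *)
Let completion_basis_size n (b : 'I_n -> nat -> F) : completion_basis w b -> n = m.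
Proof.
case=> bC b_span b_free.
have /boolp.choice[L LP] : forall i, exists Li : 'I_m -> R,
    forall j, (fun k => phi (b i k) j) @ \oo --> Li j.
  by move=> i; have /boolp.choice[Li LiP] := cauchy_phi (bC i); exists Li.
pose B : 'M[R]_(n, m) := \matrix_(i, j) L i j.
have lim_lin (c : 'I_n -> nat -> rat) (r : 'I_n -> R) j :
    (forall i, (fun k => ratr (c i k) : R) @ \oo --> r i) ->
    (fun k => phi (\sum_i ratr (c i k) * b i k) j) @ \oo --> \sum_i r i * L i j.
  move=> cr.
  rewrite (_ : (fun k => _) = (fun k => \sum_i ratr (c i k) * phi (b i k) j)).
    by apply: cvg_sumr => i; apply: cvgM (cr i) (LP i j).
  by apply/funext => k; rewrite phi_sum; apply: eq_bigr => i _; rewrite phi_rat.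
have B_free : row_free B.
  apply: inj_row_free => v vB; apply/rowP => i; rewrite mxE.
  (* Turn a real relation between the rows into rational coefficient sequences converging to it, to
     which the independence of [b] applies. *)
  have /boolp.choice[c cP] := fun i => @rat_approx R (fun=> v 0 i).
  have cv i' : (fun k => ratr (c i' k) : R) @ \oo --> v 0 i'.
    by apply: cvg_sub0 (cP i'); exact: cvg_cst.
  have c_null : null_at w (fun k => \sum_i ratr (c i k) * b i k).
    apply/null_phi => j; have := lim_lin c (v 0) j cv.
    by have /rowP/(_ j) := vB; rewrite !mxE; under eq_bigr do rewrite mxE; move=> ->.
  have cC i' : cauchy_at w (fun k => ratr (c i' k)).
    by apply/cauchy_rat; exists (v 0 i').
  have /null_rat := b_free c cC c_null i.
  by move/(norm_cvg_unique (cv i)).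
have cst_cauchy j : cauchy_at w (fun=> e j).
  by case: coord_basis.
have /boolp.choice[S SP] : forall j, exists r : 'I_n -> R,
    forall i, \sum_k r k * L k i = (i == j)%:R.
  move=> j; have [c cC c0] := b_span _ (cst_cauchy j).
  have /boolp.choice[r rP] := fun i => (cauchy_rat (c i)).1 (cC i).
  exists r => i; have := lim_lin c r i rP.
  have /null_phi/(_ i) := c0.
  under [X in X @ _]boolp.eq_fun do rewrite phiB phi_e.
  move/(cvg_sub0 (cvg_cst _)) => h1 h2; exact: (norm_cvg_unique h2 h1).
have SB : (\matrix_(j, k) S j k) *m B = 1%:M.
  apply/matrixP => j i; rewrite mxE [RHS]mxE eq_sym -SP.
  by apply: eq_bigr => k _; rewrite !mxE.
apply/eqP; rewrite eqn_leq -{1}(eqP (B_free : _ == _)) rank_leq_col /=.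
by rewrite -{1}(mxrank1 R m) -SB mulmx_max_rank.
Qed.

(** The coordinates [phi] are comparable in size with [w], so they identify the completion with real
    [m]-space, and the [e i] with its standard basis. This serves for [m = 1] at real embeddings and
    [m = 2] at the others. *)
Lemma local_degree_coord : local_degree w = m.
Proof.
apply: xget_unique => [|n [b]]; last exact: completion_basis_size.
by exists (fun i _ => e i).
Qed.

End LocalDegree.

(** * Archimedean places *)

Section AbsoluteValues.
Variables (R : realType) (F : fieldType) (w : F -> R).
Hypothesis wP : absolute_value w.

Lemma absval_ge0 x : 0 <= w x. Proof. by case: wP. Qed.
Lemma absval_eq0 x : w x = 0 <-> x = 0. Proof. by case: wP. Qed.
Lemma absvalM x y : w (x * y) = w x * w y. Proof. by case: wP. Qed.
Lemma absvalD x y : w (x + y) <= w x + w y. Proof. by case: wP. Qed.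

Lemma absval0 : w 0 = 0. Proof. exact/absval_eq0. Qed.

Lemma absval_gt0 x : x != 0 -> 0 < w x.
Proof.
move=> x0; rewrite lt0r absval_ge0 andbT.
by apply: contraNneq x0 => /absval_eq0->.
Qed.

Lemma absval1 : w 1 = 1.
Proof.
have w1 := absval_gt0 (oner_neq0 F); apply: (mulfI (lt0r_neq0 w1)).
by rewrite -absvalM !mulr1.
Qed.

Lemma absvalN x : w (- x) = w x.
Proof.
have : w (-1) ^+ 2 = 1 by rewrite expr2 -absvalM mulrNN mulr1 absval1.
move/eqP; rewrite sqrf_eq1 => /orP[/eqP E|/eqP E].
  by rewrite -mulN1r absvalM E mul1r.
by have := absval_ge0 (-1); rewrite E ler0N1.
Qed.

Lemma absvalV x : w x^-1 = (w x)^-1.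
Proof.
have [->|x0] := eqVneq x 0; first by rewrite invr0 absval0 invr0.
have wx := absval_gt0 x0; apply: (mulfI (lt0r_neq0 wx)).
by rewrite -absvalM mulfV // absval1 mulfV // lt0r_neq0.
Qed.

Lemma absvalX x n : w (x ^+ n) = w x ^+ n.
Proof. by elim: n => [|n IHn]; rewrite ?absval1 // !exprS absvalM IHn. Qed.

Lemma absval_sum (I : Type) (r : seq I) (P : pred I) (f : I -> F) :
  w (\sum_(i <- r | P i) f i) <= \sum_(i <- r | P i) w (f i).
Proof.
elim/big_rec2: _ => [|i y z _ le_zy]; first by rewrite absval0.
by rewrite (le_trans (absvalD _ _)) // lerD2l.
Qed.

Lemma absval_1D x :
  [/\ w (1 + x) <= 1 + w x, 1 - w x <= w (1 + x) & w x - 1 <= w (1 + x)].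
Proof.
split.
- by rewrite -absval1 absvalD.
- have := absvalD (1 + x) (- x); rewrite addrK absval1 absvalN; lra.
- have := absvalD (1 + x) (- 1); rewrite addrAC subrr add0r absvalN absval1; lra.
Qed.

End AbsoluteValues.

Section Powers.
Variable R : realType.
Implicit Type a : R.

Lemma near_expr_lt a d : 0 <= a -> a < 1 -> 0 < d -> \forall n \near \oo, a ^+ n < d.
Proof.
move=> a0 a1 d0; have := @cvg_expr R a; rewrite ger0_norm // => /(_ a1).
move=> /cvgr0Pnorm_lt/(_ d d0); apply: filterS => n.
by rewrite ger0_norm // exprn_ge0.
Qed.

Lemma near_expr_gt a d : 1 < a -> \forall n \near \oo, d < a ^+ n.
Proof.
move=> a1; have a0 : 0 < a by apply: lt_trans a1.
have d0 : 0 < `|d| + 1 by rewrite ltr_wpDl.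
have := @near_expr_lt a^-1 (`|d| + 1)^-1.
rewrite invr_ge0 invf_lt1 // invr_gt0 ltW // => /(_ isT a1 d0).
apply: filterS => n; rewrite exprVn ltf_pV2 ?posrE ?exprn_gt0 // => lt_d.
by apply: le_lt_trans lt_d; rewrite (le_trans (ler_norm d)) // lerDl.
Qed.

Lemma expr_bounded_le1 a M : 0 <= a -> (forall N, a ^+ N <= M) -> a <= 1.
Proof.
move=> a0 aM; rewrite leNgt; apply/negP => a1.
by have [N _ /(_ N (leqnn N))/=] := near_expr_gt M a1; rewrite ltNge aM.
Qed.

End Powers.

(* Powers of an integral [x] stay in a finitely generated group, on which [w] is
   bounded because it is at most 1 on the integers. *)
Lemma absval_int_le1 (R : realType) (F : fieldType) (w : F -> R) x :
    absolute_value w -> (forall m : int, w m%:~R <= 1) ->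
  ring_of_integers F x -> w x <= 1.
Proof.
move=> wP w_int [p mon_p rp].
apply: (@expr_bounded_le1 R _ (\sum_(i < (size p)) w x ^+ i)).
  exact: absval_ge0.
move=> N; rewrite -absvalX //.
pose q := Pdiv.CommonRing.rmodp 'X^N p.
have -> : x ^+ N = (map_poly intr q).[x].
  rewrite -[x ^+ N]hornerXn -(map_polyXn (intr : {rmorphism int -> F})).
  rewrite (Pdiv.RingMonic.rdivp_eq mon_p 'X^N) rmorphD rmorphM hornerD hornerM.
  by rewrite (eqP (rp : _ == 0)) mulr0 add0r.
have sz_q : (size (map_poly (intr : int -> F) q) <= size p)%N.
  rewrite (leq_trans (size_poly _ _)) // ltnW // Pdiv.CommonRing.ltn_rmodp.
  by rewrite monic_neq0.
rewrite (horner_coef_wide _ sz_q) (le_trans (absval_sum wP _ _ _)) //.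
apply: ler_sum => i _; rewrite absvalM // coef_map /= absvalX //.
by rewrite ler_piMl // exprn_ge0 // absval_ge0.
Qed.

Lemma padic_int_le1 (R : realType) p (m : int) : prime p ->
  padic_abs R p m%:~R <= 1.
Proof.
move=> p_pr; rewrite /padic_abs; case: eqP => [_|m0]; first exact: ler01.
rewrite numq_int denq_int /= logn1 sub0r -exprnN invf_le1.
  by rewrite exprn_ege1 // ler1n prime_gt0.
by rewrite exprn_gt0 // ltr0n prime_gt0.
Qed.

Section ArchimedeanPlaces.
Variables (R : realType) (F : fieldExtType rat).
Local Notation n := (\dim {:F}).
Variable s : 'I_n -> {rmorphism F -> R[i]}.
Hypothesis sP : full_embeddings s.

Local Notation a i x := (cabs (s i x)).
Local Notation af i := (fun x => cabs (s i x)).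

Lemma embedding_absval i : absolute_value (af i).
Proof.
split=> [x|x|x y|x y]; first exact: cabs_ge0.
- split=> [/eqP|->]; last by rewrite rmorph0 cabs0.
  by rewrite cabs_eq0 fmorph_eq0 => /eqP.
- by rewrite rmorphM cabsM.
- by rewrite rmorphD cabsD.
Qed.

Lemma embedding_absval_rat i q : a i (ratr q) = `|ratr q|.
Proof. by rewrite fmorph_rat cabs_rat. Qed.

Lemma embedding_place i : places R F (af i).
Proof. by split; [exact: embedding_absval | left; exact: embedding_absval_rat]. Qed.

Section OneArchimedeanPlace.
Variable w : F -> R.
Hypothesis wP : absolute_value w.
Hypothesis w_rat : forall q : rat, w (ratr q) = `|ratr q|.

(** The rational coordinates of [x] are fixed linear combinations of the [s i x], through the
    inverse of the embedding matrix, and [w] is the usual absolute value on rationals. *)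
Lemma absval_le_embeddings : exists C : R, forall x, w x <= C * \sum_i a i x.
Proof.
have [_ _ uB] := sP; set B := embedding_matrix _ in uB.
pose C := \sum_(j < n) (\sum_(i < n) cabs (invmx B i j)) * w (vbasis {:F})`_j.
have le_w x : w x <= \sum_(j < n) (\sum_(i < n) a i x * cabs (invmx B i j)) *
                                   w (vbasis {:F})`_j.
  rewrite {1}(coord_vbasis (memvf x)) (le_trans (absval_sum wP _ _ _)) //.
  apply: ler_sum => j _; rewrite -mulr_algl (absvalM wP) alg_num_field w_rat.
  rewrite ler_wpM2r ?(absval_ge0 wP) // -cabs_rat.
  have -> : ratr (coord (vbasis {:F}) j x) = \sum_i s i x * invmx B i j.
    have : (\row_i s i x) = (\row_k ratr (coord (vbasis {:F}) k x)) *m B.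
      apply/rowP => i; rewrite !mxE {1}(coord_vbasis (memvf x)) rmorph_sum.
      by apply: eq_bigr => k _; rewrite -mulr_algl rmorphM (embedding_alg s) !mxE.
    move/(canLR (mulmxK uB))/rowP/(_ j); rewrite !mxE => <-.
    by apply: eq_bigr => i _; rewrite !mxE.
  by rewrite (le_trans (cabs_sum _ _ _)) //; apply: ler_sum => i _; rewrite cabsM.
exists C => x; apply: le_trans (le_w x) _.
rewrite /C mulr_suml; apply: ler_sum => j _.
rewrite mulrAC ler_wpM2r ?(absval_ge0 wP) // mulr_suml; apply: ler_sum => i _.
rewrite mulrC ler_wpM2l ?cabs_ge0 // (bigD1 i) //= lerDl.
by apply: sumr_ge0 => k _; apply: cabs_ge0.
Qed.

Hypothesis w_neq : forall i, exists x, w x <> a i x.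

(** After inverting if necessary, some [x] is larger at [w] than at [s i]; divide it by a rational
    number strictly between the two values. *)
Lemma absval_separate1 i : exists x, 1 < w x /\ a i x < 1.
Proof.
have [x [x_lt]] : exists x, a i x < w x /\ x != 0.
  have [x neq_x] := w_neq i.
  have x0 : x != 0.
    by apply/eqP => x0; case: neq_x; rewrite x0 (absval0 wP) rmorph0 cabs0.
  have [lt_x|le_x] := ltP (a i x) (w x); first by exists x.
  exists x^-1; rewrite invr_eq0 x0 (absvalV wP) fmorphV cabsV; split=> //.
  rewrite ltf_pV2 ?posrE ?(absval_gt0 wP) ?embedding_cabs_gt0 //.
  by rewrite lt_neqAle le_x andbT; apply/eqP.
move=> x0; have [q] := @rat_in_itvoo R _ _ x_lt.
rewrite in_itv /= => /andP[lo hi].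
have q0 : 0 < ratr q :> R by rewrite (le_lt_trans _ lo) ?cabs_ge0.
exists (x / ratr q); rewrite (absvalM wP) (absvalV wP) w_rat rmorphM fmorphV fmorph_rat.
rewrite cabsM cabsV cabs_rat gtr0_norm //.
by rewrite ltr_pdivlMr // ltr_pdivrMr // !mul1r.
Qed.

(* Artin-Whaples: separate [w] from one more embedding at each step. *)
Lemma absval_separate (S : seq 'I_n) :
  exists x, 1 < w x /\ forall i, i \in S -> a i x < 1.
Proof.
elim: S => [|i S [y [wy ay]]].
  by exists (ratr 2%:R); rewrite w_rat ratr_nat normr_nat ltr1n.
have [x [wx ax]] := absval_separate1 i.
(* The factor [1 + a j x] makes one estimate serve both cases below: it bounds [y^N x] by 1, and
   also by [1 - |y^N|]. *)
have near_S : \forall N \near \oo, forall j, j \in S -> a j y ^+ N * (1 + a j x) < 1.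
  apply: filter_forall => j; have [jS|_] := boolP (j \in S); last by near=> N.
  have X0 : 0 < 1 + a j x by rewrite ltr_pwDl ?cabs_ge0.
  have := @near_expr_lt R (a j y) (1 + a j x)^-1 (cabs_ge0 _) (ay j jS).
  rewrite invr_gt0 X0 => /(_ isT); apply: filterS => N lt_N _.
  by rewrite -ltr_pdivlMr // div1r.
have [le_y|lt_y] := leP (a i y) 1.
  have [N _ /(_ N (leqnn N))/= NP] := near_S.
  exists (y ^+ N * x); split=> [|j].
    rewrite (absvalM wP) (absvalX wP) (lt_le_trans wx) // ler_peMl ?(absval_ge0 wP) //.
    by rewrite exprn_ege1 // ltW.
  rewrite inE rmorphM rmorphXn cabsM cabsX => /orP[/eqP->|jS].
    by rewrite (le_lt_trans _ ax) // ler_piMl ?cabs_ge0 // exprn_ile1 ?cabs_ge0.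
  have := NP j jS; have : 0 <= a j y ^+ N by rewrite exprn_ge0 ?cabs_ge0.
  by rewrite mulrDr mulr1; lra.
have near_i : \forall N \near \oo, 1 < a i y ^+ N * (1 - a i x).
  have X0 : 0 < 1 - a i x by rewrite subr_gt0.
  apply: filterS (near_expr_gt (1 - a i x)^-1 lt_y) => N.
  by rewrite -ltr_pdivrMr // div1r.
have near_w : \forall N \near \oo, 1 < w y ^+ N * (w x - 1).
  have X0 : 0 < w x - 1 by rewrite subr_gt0.
  apply: filterS (near_expr_gt (w x - 1)^-1 wy) => N.
  by rewrite -ltr_pdivrMr // div1r.
have [N _ /(_ N (leqnn N))/= [NS Ni Nw]] : \forall N \near \oo,
    [/\ forall j, j \in S -> a j y ^+ N * (1 + a j x) < 1,
        1 < a i y ^+ N * (1 - a i x) & 1 < w y ^+ N * (w x - 1)].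
  by near do split.
(* When [y] is large at [i], multiply [x] by [y^N / (1 + y^N)]: this tends to 1 where [y] has
   absolute value above 1, namely at [w] and at [i], and to 0 at the members of [S]. *)
pose v := 1 + y ^+ N.
have yN_ge0 j : 0 <= a j y ^+ N by rewrite exprn_ge0 ?cabs_ge0.
have av j : 1 - a j y ^+ N <= a j v /\ a j y ^+ N - 1 <= a j v.
  by have [_] := absval_1D (embedding_absval j) (y ^+ N);
     rewrite (absvalX (embedding_absval j)).
have i_gt0 : 0 < a i v.
  have [_] := av i; apply: lt_le_trans; rewrite subr_gt0.
  have := yN_ge0 i; have := cabs_ge0 (s i x); nra.
have v0 : v != 0 by apply: contraTneq i_gt0 => ->; rewrite rmorph0 cabs0 ltxx.
exists (y ^+ N * x / v); split=> [|j].
  have [wv _ _] := absval_1D wP (y ^+ N).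
  rewrite !(absvalM wP) (absvalV wP) (absvalX wP) ltr_pdivlMr ?(absval_gt0 wP) // mul1r.
  rewrite (le_lt_trans wv) // (absvalX wP).
  by rewrite mulrBr mulr1 in Nw; lra.
rewrite !rmorphM fmorphV rmorphXn !cabsM cabsV cabsX.
rewrite inE ltr_pdivrMr ?embedding_cabs_gt0 // mul1r => /orP[/eqP->|jS].
  have [_] := av i; apply: lt_le_trans.
  by rewrite mulrBr mulr1 in Ni; lra.
have [+ _] := av j; apply: lt_le_trans.
by have := NS j jS; rewrite mulrDr mulr1; lra.
Unshelve. all: by end_near.
Qed.

(** Take [x] large at [w] and small at every embedding: its powers stay at least 1 at [w] although
    the bound by the embeddings tends to 0. *)
Lemma absval_eq_embedding_absurd : False.
Proof.
have [C CP] := absval_le_embeddings.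
have [x [wx ax]] := absval_separate (enum 'I_n).
have : (fun N => C * \sum_i a i x ^+ N) @ \oo --> (0 : R).
  apply: cvgMl0; have : (fun N => \sum_i a i x ^+ N) @ \oo --> \sum_(i < n) (0 : R).
    apply: (@cvg_sumr _ _ (fun i N => a i x ^+ N)) => i.
    apply: cvg_expr; rewrite ger0_norm ?cabs_ge0 //.
    by apply: ax; rewrite mem_enum.
  by rewrite big1.
move=> /cvgr0Pnorm_lt/(_ 1 ltr01)[N _ /(_ N (leqnn N))/= lt1].
have := CP (x ^+ N); rewrite (absvalX wP).
under eq_bigr do rewrite rmorphXn cabsX.
move=> le_w; have := le_lt_trans (le_trans le_w (ler_norm _)) lt1.
by rewrite ltNge exprn_ege1 // ltW.
Qed.

End OneArchimedeanPlace.

Lemma archimedean_place w : absolute_value w ->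
  (forall q : rat, w (ratr q) = `|ratr q|) -> exists i, w = af i.
Proof.
move=> wP w_rat; apply: contrapT => neq_w.
apply: (absval_eq_embedding_absurd wP w_rat) => i; apply: contrapT => eq_w.
apply: neq_w; exists i; apply/funext => x; apply: contrapT => neq_x.
by apply: eq_w; exists x.
Qed.

End ArchimedeanPlaces.

(** * The height of an algebraic integer *)

Section EmbeddingDegree.
Variables (R : realType) (F : fieldExtType rat).
Local Notation n := (\dim {:F}).
Variable s : 'I_n -> {rmorphism F -> R[i]}.
Hypothesis sP : full_embeddings s.

Local Notation af i := (fun x => cabs (s i x)).
Local Notation re i x := (complex.Re (s i x)).
Local Notation im i x := (complex.Im (s i x)).

Let ReD (x y : R[i]) : complex.Re (x + y) = complex.Re x + complex.Re y.
Proof. by case: x; case: y. Qed.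

Let ImD (x y : R[i]) : complex.Im (x + y) = complex.Im x + complex.Im y.
Proof. by case: x; case: y. Qed.

Let ReM (x y : R[i]) : complex.Re (x * y) =
  complex.Re x * complex.Re y - complex.Im x * complex.Im y.
Proof. by case: x; case: y. Qed.

Let ReB (x y : R[i]) : complex.Re (x - y) = complex.Re x - complex.Re y.
Proof. by case: x; case: y. Qed.

Let ImB (x y : R[i]) : complex.Im (x - y) = complex.Im x - complex.Im y.
Proof. by case: x; case: y. Qed.

Let RatM (q : rat) (x : R[i]) :
  (complex.Re (ratr q * x) = ratr q * complex.Re x) *
  (complex.Im (ratr q * x) = ratr q * complex.Im x).
Proof.
rewrite -(fmorph_rat (real_complex R)); case: x => a b /=.
by rewrite !mul0r subr0 addr0.
Qed.

Lemma complex_eq (x y : R[i]) :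
  complex.Re x = complex.Re y -> complex.Im x = complex.Im y -> x = y.
Proof. by case: x; case: y => /= ? ? ? ? -> ->. Qed.

(* The absolute value determines the real part of every image through
   [|z+1|^2 - |z|^2 = 2 Re z + 1], hence also all products of imaginary parts. *)
Lemma eq_embedding_absval i j : af i =1 af j ->
  s i =1 s j \/ forall x, s i x = conjc (s j x).
Proof.
move=> eq_a.
have eq_re x : re i x = re j x.
  have E1 := congr1 (fun y => y ^+ 2) (eq_a x).
  have E2 := congr1 (fun y => y ^+ 2) (eq_a (x + 1)).
  move: E1 E2; rewrite /= !cabs_sqr !rmorphD !rmorph1 !ReD !ImD /=.
  by rewrite !addr0 => E1 E2; lra.
have eq_im x y : im i x * im i y = im j x * im j y.
  by have := eq_re (x * y); rewrite !rmorphM !ReM !eq_re; lra.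
have [im0|] := pselect (forall x, im i x = 0).
  left=> x; apply: complex_eq (eq_re x) _.
  have := eq_im x x; rewrite im0 mul0r => /esym/eqP.
  by rewrite mulf_eq0 orbb => /eqP.
move/existsNP => [x /eqP x_im]; have /eqP := eq_im x x.
(* The sign relating the two imaginary parts at this single [x] propagates to every [y] through
   [eq_im x y]: plus gives equal embeddings, minus conjugate ones. *)
rewrite -!expr2 eqf_sqr => /orP[/eqP E|/eqP E]; [left=> y|right=> y].
  apply: complex_eq (eq_re y) _; apply: (mulfI x_im).
  by rewrite eq_im -E.
have Ey : im i y = - im j y.
  by apply: (mulfI x_im); rewrite eq_im E mulNr mulrN opprK.
by apply: complex_eq; rewrite ?eq_re ?Ey; case: (s j y).
Qed.

Let ratrB (p q : rat) : ratr (p - q) = ratr p - ratr q :> F.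
Proof. by rewrite -!alg_num_field scalerBl. Qed.

Lemma local_degree_real i : (forall x, im i x = 0) -> local_degree (af i) = 1%N.
Proof.
move=> im0.
apply: (@local_degree_coord R F _ 1 (fun x _ => re i x) (fun=> 1) 1) => //.
- by move=> x; apply: cabs_ge0.
- by move=> q; apply: embedding_absval_rat.
- by move=> x y _; rewrite rmorphB ReB.
- by move=> q x _; rewrite rmorphM fmorph_rat RatM.
- by move=> x _; rewrite mul1r le_Re_cabs.
- move=> x; rewrite big_ord_recl big_ord0 addr0 mul1r.
  by rewrite (le_trans (cabs_le_ReIm _)) // im0 normr0 addr0.
- by move=> p q; rewrite rmorph1 !ord1 eqxx.
Qed.

Lemma local_degree_complex i x0 : im i x0 != 0 -> local_degree (af i) = 2%N.
Proof.
move=> im0; set t := im i x0; set r := re i x0.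
(* The coordinates of [s i x] in the real basis [1, s i x0] of the complex numbers, whose vectors
   come from elements of [F]. The constant [K] below is large enough for both comparisons with the
   absolute value. *)
pose phi x (j : 'I_2) := if val j == 0%N then re i x - im i x * (r / t) else im i x / t.
pose e (j : 'I_2) := if val j == 0%N then 1 else x0.
pose K := 1 + `|r / t| + `|t^-1| + `|r| + `|t|.
have t_ge0 := normr_ge0 t; have r_ge0 := normr_ge0 r.
have tV_ge0 := normr_ge0 t^-1; have rt_ge0 := normr_ge0 (r / t).
have phiM x : re i x = phi x 0 + phi x 1 * r /\ im i x = phi x 1 * t.
  by rewrite /phi /=; split; [field | field].
apply: (@local_degree_coord R F _ 2 phi e K) => //.
- by move=> x; apply: cabs_ge0.
- by move=> q; apply: embedding_absval_rat.
- by move=> x y j; rewrite /phi; case: ifP => _; rewrite rmorphB ?ReB ImB; ring.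
- move=> q x j; rewrite /phi; case: ifP => _; rewrite rmorphM fmorph_rat !RatM.
    by rewrite mulrBr !mulrA.
  by rewrite mulrA.
- move=> x j; have a0 := cabs_ge0 (s i x).
  have hr := le_Re_cabs (s i x); have hi := le_Im_cabs (s i x).
  rewrite /phi; case: ifP => _.
    rewrite (le_trans (ler_normB _ _)) // normrM.
    have : `|im i x| * `|r / t| <= cabs (s i x) * `|r / t| by rewrite ler_wpM2r.
    rewrite /K; set A := cabs _ in a0 hr hi *; set B := `|r / t| in rt_ge0 *.
    nra.
  rewrite normrM.
  have : `|im i x| * `|t^-1| <= cabs (s i x) * `|t^-1| by rewrite ler_wpM2r.
  rewrite /K; set A := cabs _ in a0 hr hi *; set B := `|t^-1| in tV_ge0 *.
  nra.
- move=> x; have [Er Ei] := phiM x.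
  rewrite (le_trans (cabs_le_ReIm _)) // Er Ei.
  rewrite big_ord_recl big_ord_recl big_ord0 addr0.
  have -> : lift ord0 ord0 = 1 :> 'I_2 by apply: val_inj.
  have -> : ord0 = 0 :> 'I_2 by [].
  apply: (@le_trans _ _ (`|phi x 0| + `|phi x 1| * `|r| + `|phi x 1| * `|t|)).
    by rewrite normrM lerD2r -normrM ler_normD.
  have := normr_ge0 (phi x 0); have := normr_ge0 (phi x 1); rewrite /K.
  set A := `|phi x 0|; set B := `|phi x 1| => B0 A0.
  nra.
- move=> p q; rewrite /phi /e.
  case: p => [[|[|//]] lp]; case: q => [[|[|//]] lq] //=; rewrite ?rmorph1 /=.
  + by rewrite mul0r subr0.
  + by rewrite -/t -/r; field.
  + by rewrite mul0r.
  + by rewrite -/t divff.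
- by rewrite /K; lra.
Qed.

(** A real embedding shares its absolute value with no other index, a nonreal one exactly with its
    conjugate. Weighting places by local degree thus amounts to summing over all embeddings. *)
Lemma local_degree_embedding i :
  local_degree (af i) = #|[pred j | `[< af j = af i >]]|.
Proof.
have [s_inj _ _] := sP.
have same j : af j = af i -> s j =1 s i \/ forall x, s j x = conjc (s i x).
  by move=> E; apply: eq_embedding_absval => x; rewrite -[cabs _]/(af j x) E.
have [im0|] := pselect (forall x, im i x = 0).
  rewrite (local_degree_real im0) -(card1 i); apply: eq_card => j.
  rewrite !inE; apply/eqP/asboolP => [->//|/same[/s_inj//|E]].
  apply: s_inj => x; rewrite E; apply: complex_eq; case: (s i x) (im0 x) => //=.
  by move=> _ b ->; rewrite oppr0.
move/existsNP => [x0 /eqP x0_im]; rewrite (local_degree_complex x0_im).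
have [c cP] := conj_index sP.
have c_neq : c i != i.
  apply: contraNneq x0_im => E; have := cP i x0; rewrite E.
  move/(congr1 (@complex.Im R)); case: (s i x0) => /= _ b; lra.
transitivity #|[set i; c i]%SET|; first by rewrite cards2 eq_sym c_neq.
apply: eq_card => j; rewrite !inE; apply/orP/asboolP.
  case=> /eqP-> //; apply/funext => x; by rewrite cP cabs_conj.
case/same => [/s_inj->|E]; first by left.
by right; apply/eqP/s_inj => x; rewrite E cP.
Qed.

(** At the p-adic places an integral element has absolute value at most 1 and contributes
    nothing. *)
Lemma height_integer x : x != 0 -> ring_of_integers F x ->
  height R x = (n%:R^-1 * \sum_i Num.max 0 (ln (cabs (s i x))))%:E.
Proof.
move=> x0 xI.
have n_gt0 : (0 : R) < n%:R by rewrite ltr0n dim_field_gt0.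
pose g w : \bar R := (n%:R^-1 * Num.max 0 (ln (w x)))%:E.
have max_ge0 (y : R) : 0 <= Num.max 0 y by rewrite le_max lexx.
have g_ge0 w : (0 <= g w)%E by rewrite lee_fin mulr_ge0 // invr_ge0 ltW.
(* Distribute the contribution of each place over the indices [j] that give it, so that exchanging
   the sums leaves one place for each [j]. *)
transitivity (\esum_(w in places R F)
    \sum_(j < n) (if w \in [set af j] then g w else 0%E))%E.
  apply: eq_esum => w w_pl; rewrite /normalized_abs.
  have [[i Dw]|not_arch] := pselect (exists i, w = af i).
    rewrite Dw local_degree_embedding.
    pose h : R := n%:R^-1 * Num.max 0 (ln (cabs (s i x))).
    transitivity (\sum_(j < n) (if `[< af j = af i >] then h else 0)%:E)%E; last first.
      apply: eq_bigr => j _; case: asboolP => [->|neq_j].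
        by rewrite mem_set.
      by rewrite memNset // => E; case: neq_j.
    rewrite sumEFin -big_mkcond sumr_const /log_plus ln_powR; congr EFin.
    by rewrite -[RHS]mulr_natl /h mulrA maxr_pMr ?divr_ge0 // mulr0.
  rewrite big1 => [|j _]; last first.
    case: ifPn => //; rewrite inE => E; by case: not_arch; exists j.
  case: w_pl => wP [w_rat|[p p_pr w_rat]].
    by case: not_arch; apply: archimedean_place.
  have w_le1 : w x <= 1.
    apply: absval_int_le1 => // m.
    by have := padic_int_le1 R m p_pr; rewrite -w_rat ratr_int.
  by rewrite /log_plus max_l // ln_powR mulr_ge0_le0 ?divr_ge0 ?ln_le0.
rewrite esum_sum => [|w j _ _]; last by case: ifP.
under eq_bigr => j _.
  rewrite -esum_mkcondr (_ : _ `&` _ = [set af j]) ?esum_set1 //.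
    over.
  by rewrite setIC; apply/setIidPl => _ ->; apply: embedding_place.
by rewrite sumEFin mulr_sumr.
Qed.

End EmbeddingDegree.

(** * Units and their logarithms *)

Section UnitGroup.
Variable F : fieldType.

Lemma units1 : integer_units F 1.
Proof. by split; rewrite ?invr1 ?oner_eq0 //; exact: intring1. Qed.

Lemma unitsM x y : integer_units F x -> integer_units F y -> integer_units F (x * y).
Proof.
move=> [x0 xI xVI] [y0 yI yVI]; split; first by rewrite mulf_neq0.
  exact: intringM.
by rewrite invfM; apply: intringM.
Qed.

Lemma unitsV x : integer_units F x -> integer_units F x^-1.
Proof. by move=> [x0 xI xVI]; split; rewrite ?invrK ?invr_eq0. Qed.

Lemma unitsXz x (z : int) : integer_units F x -> integer_units F (x ^ z).
Proof.
move=> xU; have xX k : integer_units F (x ^+ k).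
  by elim: k => [|k IHk]; [exact: units1 | rewrite exprS; apply: unitsM].
case: z => k; first exact: xX.
by rewrite NegzE -exprnN; apply/unitsV/xX.
Qed.

Lemma units_prod (I : Type) (r : seq I) (P : pred I) (f : I -> F) :
    (forall i, P i -> integer_units F (f i)) ->
  integer_units F (\prod_(i <- r | P i) f i).
Proof. by move=> fU; elim/big_ind: _ => //; [exact: units1 | exact: unitsM]. Qed.

End UnitGroup.

Section LogEmbedding.
Variables (R : realType) (F : fieldExtType rat).
Local Notation n := (\dim {:F}).
Variable s : 'I_n -> {rmorphism F -> R[i]}.

Definition logvec (x : F) : 'rV[R]_n := \row_i ln (cabs (s i x)).

Definition logmx m (u : 'I_m -> F) : 'M[R]_(m, n) := \matrix_i logvec (u i).

Lemma logvec1 : logvec 1 = 0.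
Proof. by apply/rowP => i; rewrite !mxE rmorph1 cabs1 ln1. Qed.

Lemma logvecM x y : x != 0 -> y != 0 -> logvec (x * y) = logvec x + logvec y.
Proof.
move=> x0 y0; apply/rowP => i; rewrite !mxE rmorphM cabsM lnM //.
  by rewrite posrE embedding_cabs_gt0.
by rewrite posrE embedding_cabs_gt0.
Qed.

Lemma logvecV x : x != 0 -> logvec x^-1 = - logvec x.
Proof.
move=> x0; apply/rowP => i; rewrite !mxE fmorphV cabsV lnV //.
by rewrite posrE embedding_cabs_gt0.
Qed.

Lemma logvecX x k : x != 0 -> logvec (x ^+ k) = k%:R *: logvec x.
Proof.
move=> x0; elim: k => [|k IHk]; first by rewrite expr0 logvec1 scale0r.
by rewrite exprS logvecM ?expf_neq0 // IHk -natr1 scalerDl scale1r addrC.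
Qed.

Lemma logvecXz x (z : int) : x != 0 -> logvec (x ^ z) = z%:~R *: logvec x.
Proof.
move=> x0; case: z => k; first by rewrite logvecX.
by rewrite NegzE -exprnN logvecV ?expf_neq0 // logvecX // mulrNz scaleNr.
Qed.

Lemma logvec_prod m (u : 'I_m -> F) (z : 'I_m -> int) : (forall i, u i != 0) ->
  logvec (\prod_i u i ^ z i) = \sum_i (z i)%:~R *: logvec (u i).
Proof.
move=> u0; suff [] : \prod_i u i ^ z i != 0 /\
  logvec (\prod_i u i ^ z i) = \sum_i (z i)%:~R *: logvec (u i) by [].
elim/big_rec2: _ => [|i y x _ [x0 <-]]; first by rewrite oner_eq0 logvec1.
by rewrite mulf_neq0 ?expfz_neq0 // logvecM ?expfz_neq0 // logvecXz.
Qed.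

Lemma mul_logmx m (u : 'I_m -> F) (v : 'rV[R]_m) :
  v *m logmx u = \sum_i v 0 i *: logvec (u i).
Proof. by rewrite mulmx_sum_row; apply: eq_bigr => i _; rewrite rowK. Qed.

Hypothesis sP : full_embeddings s.

(* A real relation [sum t_i log u_i = 0] with [t_i0 = 1] makes the units
   [prod u_i ^ floor (k t_i)], [k = 0, 1, ...], pairwise distinct and bounded. *)
Lemma mult_independent_row_free m (u : 'I_m -> F) :
  (forall i, integer_units F (u i)) -> mult_independent u -> row_free (logmx u).
Proof.
move=> uU ind_u; have u0 j : u j != 0 by case: (uU j).
apply: inj_row_free => v v0; apply/eqP/negPn/negP => /rV0Pn[i0 vi0].
pose t := (v 0 i0)^-1 *: v.
have t0 : \sum_i t 0 i *: logvec (u i) = 0.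
  by rewrite -mul_logmx -scalemxAl v0 scaler0.
have ti0 : t 0 i0 = 1 by rewrite mxE mulVf.
pose z (k : nat) i := Num.floor (k%:R * t 0 i).
pose g k := \prod_i u i ^ z k i.
pose B := expR (\sum_i \sum_j `|ln (cabs (s j (u i)))|).
have gU k : integer_units F (g k).
  by apply: units_prod => i _; apply: unitsXz.
have [N NP] := bounded_integers_finite sP B.
apply: (NP (fun k : 'I_N => g k)).
- by move=> k; case: (gU k).
- move=> k j; have g_gt0 : 0 < cabs (s j (g k)).
    by apply: embedding_cabs_gt0; case: (gU k).
  rewrite -(lnK g_gt0) ler_expR.
  (* Subtracting [k] times the relation leaves only the fractional parts of the exponents, so the
     bound [B] is uniform in [k]. *)
  have -> : ln (cabs (s j (g k))) =
      \sum_i ((z k i)%:~R - k%:R * t 0 i) * ln (cabs (s j (u i))).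
    have t0j : \sum_i t 0 i * ln (cabs (s j (u i))) = 0.
      have /(congr1 (fun w : 'rV[R]_n => w 0 j)) := t0.
      rewrite summxE [RHS]mxE => E; rewrite -[RHS]E.
      by apply: eq_bigr => i _; rewrite !mxE.
    transitivity (\sum_i (z k i)%:~R * ln (cabs (s j (u i))) -
                  k%:R * \sum_i t 0 i * ln (cabs (s j (u i)))).
      rewrite t0j mulr0 subr0.
      have := congr1 (fun w : 'rV[R]_n => w 0 j) (logvec_prod (z k) u0).
      rewrite mxE summxE => ->; by apply: eq_bigr => i _; rewrite !mxE.
    by rewrite mulr_sumr -sumrB; apply: eq_bigr => i _; rewrite mulrBl mulrA.
  rewrite (le_trans (ler_norm _)) // (le_trans (ler_norm_sum _ _ _)) //.
  apply: ler_sum => i _; rewrite normrM.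
  apply: (@le_trans _ _ (1 * `|ln (cabs (s j (u i)))|)).
    apply: ler_wpM2r => //; have := floor_itv (k%:R * t 0 i).
    by rewrite -/(z k i) intrD ler_norml => /andP[lo hi]; apply/andP; split; lra.
  rewrite mul1r (bigD1 j) //= lerDl.
  by apply: sumr_ge0.
- move=> k k' eq_g; apply: val_inj => /=.
  have : \prod_i u i ^ (z k i - z k' i) = 1.
    have g0 : g k' != 0.
      by rewrite /g; apply/prodf_neq0 => i _; rewrite expfz_neq0.
    apply: (mulIf g0); rewrite mul1r -[RHS]eq_g /g -big_split.
    by apply: eq_bigr => i _ /=; rewrite -expfzDr // subrK.
  (* Since [t 0 i0 = 1], the exponents at [i0] are [k] and [k'] themselves. *)
  move/ind_u/(_ i0)/eqP; rewrite subr_eq0 /z ti0 !mulr1.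
  by rewrite -[k%:R]/(k%:Z%:~R) -[k'%:R]/(k'%:Z%:~R) !intrKfloor => /eqP[].
Qed.

(** Row freeness of logarithms bounds the size of independent families by [n], so a largest one
    exists. It identifies the multiplicative rank with the dimension of the real span of the
    logarithms. *)
Lemma unit_rank_basis : exists u : 'I_(unit_rank F) -> F,
  [/\ forall i, integer_units F (u i), row_free (logmx u)
    & forall x, integer_units F x -> (logvec x <= logmx u)%MS].
Proof.
pose P r := `[< exists2 u : 'I_r -> F,
  (forall i, integer_units F (u i)) & mult_independent u >].
have P0 : exists r, P r.
  exists 0%N; apply/asboolP; exists (fun _ => 1) => [_|z _ []//].
  exact: units1.
have P_le r : P r -> (r <= n)%N.
  case/asboolP => u uU ind_u.
  by rewrite -(eqP (mult_independent_row_free uU ind_u : _ == _)) rank_leq_col.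
case: (ex_maxnP P0 P_le) => r /asboolP[u uU ind_u] r_max.
have rank_r : has_rank (integer_units F) r.
  by split=> [|m x xU ind_x]; [exists u | apply/r_max/asboolP; exists x].
have -> : unit_rank F = r.
  apply: xget_unique => // r' [[u' u'U ind_u'] r'_max].
  have [_ r_top] := rank_r.
  by apply/eqP; rewrite eqn_leq (r_top _ u' u'U ind_u') (r'_max _ u uU ind_u).
have free_u := mult_independent_row_free uU ind_u.
exists u; split=> // x xU; apply/negPn/negP => x_notin.
suff : P r.+1 by move/r_max; rewrite ltnn.
have u0 j : u j != 0 by case: (uU j).
have x0 : x != 0 by case: xU.
(* If [logvec x] lay outside the span, adjoining [x] at index [ord0] would give a larger independent
   family. *)
apply/asboolP; exists (fun i => oapp u x (unlift ord0 i)) => [i|z].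
  by case: unliftP => [j|] _ /=; [exact: uU | exact: xU].
rewrite big_ord_recl unlift_none /=; under eq_bigr => i _ do rewrite liftK /=.
move/(congr1 logvec); rewrite logvec1 logvecM ?expfz_neq0 //; last first.
  by apply/prodf_neq0 => i _; rewrite expfz_neq0.
rewrite logvecXz // logvec_prod //.
have -> : \sum_i (z (lift ord0 i))%:~R *: logvec (u i) =
    (\row_i (z (lift ord0 i))%:~R) *m logmx u.
  by rewrite mul_logmx; apply: eq_bigr => i _; rewrite mxE.
move=> E; have z0 : z ord0 = 0.
  apply/eqP/negPn/negP => z0; case/negP: x_notin.
  have zR : (z ord0)%:~R != 0 :> R by rewrite intr_eq0.
  have -> : logvec x =
      (- (z ord0)%:~R^-1 *: \row_i (z (lift ord0 i))%:~R) *m logmx u.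
    by rewrite -scalemxAl -(addr0_eq E) scaleNr scalerN opprK scalerA mulVf // scale1r.
  exact: submxMl.
move: E; rewrite z0 scale0r add0r -[RHS](mul0mx _ (logmx u)).
move/(row_free_inj free_u)/rowP => E i.
case: (unliftP ord0 i) => [j|] -> //.
by have := E j; rewrite !mxE => /eqP; rewrite intr_eq0 => /eqP.
Qed.

End LogEmbedding.

(** * The unit theorem *)

Section DirichletUnits.
Variables (R : realType) (F : fieldExtType rat).
Local Notation n := (\dim {:F}).
Variable s : 'I_n -> {rmorphism F -> R[i]}.
Hypothesis sP : full_embeddings s.
Variable c : 'I_n -> 'I_n.
Hypothesis cP : forall i x, s (c i) x = conjc (s i x).

Variable b : 'I_n -> F.
Hypothesis b_int : forall j, ring_of_integers F (b j).
Hypothesis b_free : forall z : 'I_n -> int,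
  \sum_j (z j)%:~R * b j = 0 -> forall j, z j = 0.

Local Notation comb z := (\sum_j (z j)%:~R * b j).

Lemma comb_int (z : 'I_n -> int) : ring_of_integers F (comb z).
Proof. by apply: intring_sum => j _; apply: intringM => //; apply: intring_int. Qed.

(* [lam i] and [lam (c i)] are the real coordinates [Re + Im] and [Re - Im]. *)
Definition lam i x : R := complex.Re (s i x) + complex.Im (s i x).

Lemma lamD i x y : lam i (x + y) = lam i x + lam i y.
Proof. by rewrite /lam rmorphD; case: (s i x) => ? ?; case: (s i y) => ? ? /=; ring. Qed.

Lemma lam_sum i m (f : 'I_m -> F) : lam i (\sum_j f j) = \sum_j lam i (f j).
Proof.
rewrite (big_morph _ (lamD i) (_ : lam i 0 = 0)) //.
by rewrite /lam rmorph0 addr0.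
Qed.

Lemma lamZ i (m : int) x : lam i (m%:~R * x) = m%:~R * lam i x.
Proof.
rewrite /lam rmorphM rmorph_int -(rmorph_int (real_complex R)).
by case: (s i x) => ? ? /=; ring.
Qed.

Lemma cabs_lam i x : cabs (s i x) ^+ 2 = (lam i x ^+ 2 + lam (c i) x ^+ 2) / 2.
Proof. by rewrite cabs_sqr /lam cP; case: (s i x) => ? ? /=; field. Qed.

Lemma cabs_le_lam i x B : 0 <= B -> `|lam i x| <= B -> `|lam (c i) x| <= B ->
  cabs (s i x) <= B.
Proof.
move=> B0 h1 h2; rewrite -(@ler_pXn2r _ 2) ?nnegrE ?cabs_ge0 // cabs_lam.
have le_sqr y : `|y| <= B -> y ^+ 2 <= B ^+ 2.
  by move=> hy; rewrite -(real_normK (num_real y)) ler_pXn2r ?nnegrE.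
by have := le_sqr _ h1; have := le_sqr _ h2; lra.
Qed.

Lemma pigeonhole (T : finType) (M : 'I_n -> nat) (f : T -> 'I_n -> nat) :
    (forall x i, (f x i < M i)%N) -> (\prod_i M i < #|T|)%N ->
  exists x y : T, x != y /\ forall i, f x i = f y i.
Proof.
move=> f_lt M_lt; apply: contrapT => no_coll.
pose g x : {dffun forall i, 'I_(M i)} := [ffun i => Ordinal (f_lt x i)].
have g_inj : injective g.
  move=> x y /ffunP eq_g; apply/eqP/negPn/negP => neq_xy; apply: no_coll.
  by exists x, y; split=> // i; have := eq_g i; rewrite !ffunE => /(congr1 val).
have := leq_card g g_inj; rewrite leqNgt card_dep_ffun foldrE big_map big_enum /=.
by under eq_bigr => i _ do rewrite card_ord; rewrite M_lt.
Qed.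

(* Pigeonhole form of Minkowski's linear forms theorem: for [N] large (depending
   on [v]), the [(N+1)^n] combinations with coefficients in [0..N] fall into at
   most [prod_i N exp(-v_i) = N^n] boxes of sides [C exp(v_i)]. *)
Lemma small_integer : exists2 C : R, 1 <= C & forall v : 'I_n -> R,
  (forall i, v (c i) = v i) -> \sum_i v i = 0 ->
  exists z : 'I_n -> int, comb z != 0 /\
    forall i, cabs (s i (comb z)) <= C * expR (v i).
Proof.
pose K := 1 + \sum_i \sum_j `|lam i (b j)|.
have K_ge1 : 1 <= K.
  by rewrite lerDl; apply: sumr_ge0 => i _; apply: sumr_ge0.
have K_gt0 : 0 < K by apply: lt_le_trans K_ge1.
exists (4 * K) => [|v v_conj v_sum]; first by lra.
(* Taking [N] at least every [2 exp(v_i)] makes each [E i] at least 1, so that the [floor (E i) + 1]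
   boxes in direction [i] number at most [2 E i = N exp(-v_i)]. *)
pose A := \sum_i 2 * expR (v i).
have A_ge0 : 0 <= A by apply: sumr_ge0 => i _; rewrite mulr_ge0 ?expR_ge0.
pose N := (Num.bound A).+1.
have N_ge i : 2 * expR (v i) <= N%:R.
  have le_A : 2 * expR (v i) <= A.
    rewrite /A (bigD1 i) //= lerDl; apply: sumr_ge0 => k _.
    by rewrite mulr_ge0 ?expR_ge0.
  by rewrite (le_trans le_A) // ltW // (lt_trans (archi_boundP A_ge0)) // ltr_nat.
have N_gt0 : 0 < N%:R :> R by rewrite ltr0n.
pose y (f : {ffun 'I_n -> 'I_N.+1}) i := \sum_j (f j)%:R * lam i (b j).
have y_le f i : `|y f i| <= N%:R * K.
  rewrite (le_trans (ler_norm_sum _ _ _)) //.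
  apply: (@le_trans _ _ (\sum_j N%:R * `|lam i (b j)|)).
    apply: ler_sum => j _; rewrite normrM ler_wpM2r // normr_nat ler_nat.
    by rewrite -ltnS.
  rewrite -mulr_sumr ler_wpM2l // /K [leRHS](_ : _ =
    \sum_j `|lam i (b j)| + (1 + \sum_(k | k != i) \sum_j `|lam k (b j)|)).
    by rewrite lerDl addr_ge0 // sumr_ge0 // => k _; apply: sumr_ge0.
  by rewrite (bigD1 i) //= addrCA.
(* The value of the form, shifted to be nonnegative and measured in units of the box side
   [4 K exp(v_i)]; its integer part is the number of the box. *)
pose X f i := (y f i + N%:R * K) * expR (- v i) / (4 * K).
pose E i : R := N%:R * expR (- v i) / 2.
have X_itv f i : 0 <= X f i <= E i.
  have := y_le f i; rewrite ler_norml => /andP[lo hi].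
  have e0 := expR_gt0 (- v i); have K4 : 0 < 4 * K by rewrite mulr_gt0.
  apply/andP; split.
    by rewrite /X divr_ge0 ?(ltW K4) // mulr_ge0 ?expR_ge0 //; lra.
  rewrite /X ler_pdivrMr // /E.
  have -> : N%:R * expR (- v i) / 2 * (4 * K) = (N%:R * K + N%:R * K) * expR (- v i).
    by field.
  by rewrite ler_wpM2r ?expR_ge0 // lerD2r.
have E_ge1 i : 1 <= E i.
  rewrite /E expRN ler_pdivlMr // mul1r ler_pdivlMr ?expR_gt0 //.
have [||f [f' [neq_f eq_f]]] := @pigeonhole {ffun 'I_n -> 'I_N.+1}
    (fun i => (Num.truncn (E i)).+1) (fun f i => Num.truncn (X f i)).
- by move=> f i; rewrite ltnS le_truncn //; case/andP: (X_itv f i).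
- rewrite card_ffun !card_ord -(ltr_nat R) natr_prod.
  apply: (@le_lt_trans _ _ (\prod_i (N%:R * expR (- v i)))).
    apply: ler_prod => i _; rewrite ler0n -natr1 /=.
    have : (Num.truncn (E i))%:R <= E i by rewrite truncn_le (le_trans _ (E_ge1 i)).
    have := E_ge1 i; have -> : N%:R * expR (- v i) = E i + E i by rewrite /E; field.
    by lra.
  rewrite big_split /= prodr_const card_ord -expR_sum sumrN v_sum oppr0 expR0 mulr1.
  rewrite -natrX ltr_nat ltn_exp2r //; exact: dim_field_gt0.
pose z j := (f j)%:Z - (f' j)%:Z.
have lam_z i : lam i (comb z) = y f i - y f' i.
  rewrite lam_sum -sumrB; apply: eq_bigr => j _.
  by rewrite lamZ -mulrBl intrB.
exists z; split.
  apply: contraNneq neq_f => z0; apply/eqP/ffunP => j; apply: val_inj.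
  by have /eqP := b_free z0 j; rewrite subr_eq0 => /eqP[].
have lam_le i : `|lam i (comb z)| <= 4 * K * expR (v i).
  have /andP[X0 _] := X_itv f i; have /andP[X0' _] := X_itv f' i.
  have /andP[lo hi] := truncn_itv X0; have /andP[lo' hi'] := truncn_itv X0'.
  rewrite -natr1 in hi; rewrite -natr1 in hi'.
  have Xd : `|X f i - X f' i| <= 1.
    by rewrite (eq_f i) in lo hi; rewrite ler_norml; apply/andP; split; lra.
  have -> : lam i (comb z) = (X f i - X f' i) * (4 * K * expR (v i)).
    have K0 := lt0r_neq0 K_gt0; have e0 := lt0r_neq0 (expR_gt0 (v i)).
    by rewrite lam_z /X expRN; field; rewrite ?K0 ?e0.
  rewrite normrM [`|4 * K * _|]ger0_norm ?ler_piMl //.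
    by rewrite !mulr_ge0 ?expR_ge0 // ltW.
  by rewrite !mulr_ge0 ?expR_ge0 // ltW.
(* Invariance of [v] under conjugation gives the coordinates [i] and [c i] the same bound, as the
   absolute value requires. *)
move=> i; apply: cabs_le_lam => //.
  by rewrite !mulr_ge0 ?expR_ge0 // ltW.
by rewrite -(v_conj i).
Qed.

Section Associates.
Variables (m : nat) (z z' : 'I_n -> int).
Hypothesis z'_neq0 : comb z' != 0.
Hypothesis z'_norm : \prod_i cabs (s i (comb z')) = m%:R.
Hypothesis eq_z : forall j, (z j = z' j %[mod m])%Z.

(* [comb z = comb z' + m a] and [m], up to sign the norm of [comb z'], is an
   integral multiple of [comb z']. *)
Lemma congruent_dvd_int : ring_of_integers F (comb z / comb z').
Proof.
have m_int : ring_of_integers F (m%:~R / comb z').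
  have [m' Dm'] := norm_int sP (comb_int z').
  have [sg Dm] : exists sg : int, m%:~R = sg%:~R * m'%:~R :> R[i].
    exists (if 0 <= m' then 1 else -1).
    have : `|m'| = m%:Z.
      apply: (@intr_inj R); rewrite intr_norm -cabs_int -Dm' cabs_prod z'_norm.
      by [].
    by move=> <-; case: ger0P => _; rewrite -intrM ?mul1r ?mulN1r.
  (* Under one embedding, [m / comb z'] is up to sign the product of the remaining conjugates. *)
  pose i0 := Ordinal (dim_field_gt0 F).
  apply/(intring_morph (s i0)); rewrite rmorphM fmorphV rmorph_int Dm -Dm'.
  rewrite (bigD1 i0) //= [X in sg%:~R * X]mulrC mulrA.
  rewrite mulfK ?fmorph_eq0 //; apply: intringM; first exact: intring_int.
  by apply: intring_prod => i _; apply/intring_morph; apply: comb_int.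
have -> : comb z = comb z' + m%:~R * comb (fun j => (z j - z' j) %/ m)%Z.
  rewrite mulr_sumr -big_split; apply: eq_bigr => j _ /=.
  rewrite mulrA -mulrDl -intrM -intrD; congr (_%:~R * _).
  have /eqP := eq_z j; rewrite eqz_mod_dvd => dv.
  by rewrite mulrC divzK // addrC subrK.
rewrite mulrDl divff // mulrAC; apply: intringD; first exact: intring1.
by apply: intringM => //; apply: comb_int.
Qed.

End Associates.

(** An integer whose conjugates are at most [C exp(v_i)] has norm at most [C^n]. Sort such integers
    by norm and by coefficients modulo the norm: members of one class are associates, so dividing by
    a fixed representative of the class yields a unit. *)
Lemma log_units_cocompact : exists D : R, forall v : 'I_n -> R,
  (forall i, v (c i) = v i) -> \sum_i v i = 0 ->
  exists2 u, integer_units F u & forall i, `|v i - ln (cabs (s i u))| <= D.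
Proof.
have [C C_ge1 small] := small_integer.
have C_gt0 : 0 < C by apply: lt_le_trans C_ge1.
pose T := Num.truncn (C ^+ n).
pose Q (k : 'I_T.+1 * {ffun 'I_n -> 'I_T.+1}) (z : 'I_n -> int) :=
  [/\ comb z != 0, (0 < k.1)%N, \prod_i cabs (s i (comb z)) = k.1%:R
    & forall j, (z j = k.2 j %[mod k.1])%Z].
have /boolp.choice[rep repP] : forall k, exists z, (exists z', Q k z') -> Q k z.
  move=> k; have [[z Qz]|noQ] := pselect (exists z, Q k z); first by exists z.
  by exists (fun=> 0).
(* There are finitely many classes, so one constant bounds the logarithms of all representatives. *)
pose D0 := \sum_k \sum_i `|ln (cabs (s i (comb (rep k))))|.
exists (n%:R * ln C + D0) => v v_conj v_sum.
have [z [z0 z_le]] := small v v_conj v_sum.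
have [m m_gt0 Dm] := norm_abs_nat sP z0 (comb_int z).
have m_le : (m <= T)%N.
  have C_ge0 := ltW C_gt0; rewrite truncn_ge_nat ?exprn_ge0 // -Dm.
  apply: (@le_trans _ _ (\prod_i (C * expR (v i)))).
    by apply: ler_prod => i _; rewrite cabs_ge0 z_le.
  by rewrite big_split /= prodr_const card_ord -expR_sum v_sum expR0 mulr1.
pose k : 'I_T.+1 * {ffun 'I_n -> 'I_T.+1} :=
  (inord m, [ffun j => inord (absz (z j %% m)%Z)]).
have k1 : k.1 = m :> nat by rewrite inordK.
have Qk : Q k z.
  split; rewrite ?k1 // => j; rewrite ffunE.
  have m0 : m%:Z != 0 by rewrite eqz_nat -lt0n.
  rewrite inordK; first by rewrite gez0_abs ?modz_ge0 // modz_mod.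
  rewrite ltnS (leq_trans _ m_le) // -lez_nat gez0_abs ?modz_ge0 // ltW //.
  by rewrite ltz_pmod // ltz_nat.
have [z'0 _ Dm' z'_mod] := repP k (ex_intro _ z Qk).
have [_ _ _ z_mod] := Qk; rewrite k1 in Dm' z'_mod z_mod.
exists (comb z / comb (rep k)).
  split; first by rewrite mulf_neq0 ?invr_eq0.
    by apply: (@congruent_dvd_int m) => // j; rewrite z_mod z'_mod.
  rewrite invf_div.
  by apply: (@congruent_dvd_int m) => // j; rewrite z_mod z'_mod.
move=> i; rewrite rmorphM fmorphV cabsM cabsV ln_div ?posrE ?embedding_cabs_gt0 //.
rewrite opprB addrCA addrC; apply: le_trans (ler_normD _ _) _; apply: lerD.
  (* The gaps in the upper bounds are nonnegative, and since the norm is at least 1 they add up to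
     at most [n ln C]; hence each gap is bounded. *)
  pose x i := ln C + v i - ln (cabs (s i (comb z))).
  have x_ge0 j : 0 <= x j.
    rewrite subr_ge0 -[v j]expRK -lnM ?posrE ?expR_gt0 //.
    by rewrite ler_ln ?posrE ?embedding_cabs_gt0 // ?mulr_gt0 ?expR_gt0.
  have x_sum : \sum_j x j <= n%:R * ln C.
    rewrite sumrB big_split /= v_sum addr0 sumr_const card_ord mulr_natl.
    rewrite lerBlDr lerDl -ln_prod => [|j]; last exact: embedding_cabs_gt0.
    by rewrite Dm ln_ge0 // ler1n.
  have x_le : x i <= n%:R * ln C.
    by apply: le_trans x_sum; rewrite (bigD1 i) //= lerDl sumr_ge0.
  have lnC : 0 <= ln C by rewrite ln_ge0.
  have le_n : ln C <= n%:R * ln C by rewrite ler_peMl // ler1n dim_field_gt0.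
  have := x_ge0 i; rewrite /x in x_le * => x_ge.
  by rewrite ler_norml; apply/andP; split; lra.
apply: (@le_trans _ _ (\sum_i `|ln (cabs (s i (comb (rep k))))|)).
  by rewrite [leRHS](bigD1 i) //= lerDl sumr_ge0.
rewrite /D0 [leRHS](bigD1 k) //= lerDl.
by apply: sumr_ge0 => k' _; apply: sumr_ge0.
Qed.

(** A linear form vanishing on [A] kills all logarithms of units. Every multiple [t v] is within [D]
    of such a logarithm, so the form is bounded on the line through [v] and therefore zero there.
    The columns of [cokermx A] supply the forms. *)
Lemma log_units_span m (A : 'M[R]_(m, n)) (v : 'rV[R]_n) :
    (forall x, integer_units F x -> (logvec s x <= A)%MS) ->
    (forall i, v 0 (c i) = v 0 i) -> \sum_i v 0 i = 0 ->
  (v <= A)%MS.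
Proof.
move=> A_span v_conj v_sum; have [D DP] := log_units_cocompact.
rewrite submxE; apply/eqP/rowP => j; rewrite [RHS]mxE.
set y := _ j; pose E := D * \sum_i `|cokermx A i j|.
have bound t : `|t * y| <= E.
  have [||u uU uP] := DP (fun i => t * v 0 i).
  - by move=> i; rewrite v_conj.
  - by rewrite -mulr_sumr v_sum mulr0.
  have -> : t * y = ((t *: v - logvec s u) *m cokermx A) 0 j.
    have := A_span u uU; rewrite submxE => /eqP u0.
    by rewrite mulmxBl u0 subr0 -scalemxAl mxE.
  rewrite mxE (le_trans (ler_norm_sum _ _ _)) // /E mulr_sumr.
  by apply: ler_sum => i _; rewrite normrM ler_wpM2r // !mxE uP.
apply/eqP/negPn/negP => y0.
have := bound ((`|E| + 1) / y); rewrite divfK //.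
by rewrite ger0_norm ?addr_ge0 //; have := ler_norm E; lra.
Qed.

End DirichletUnits.

(** * Relative units *)

Section RelativeNorm.
Variables (R : realType) (k : fieldExtType rat) (l : fieldExtType k).
Local Notation L := (baseFieldType l).
Local Notation nl := (\dim {:L}).
Local Notation nk := (\dim {:k}).
Local Notation e := (\dim {:l}).
Variables (s : 'I_nl -> {rmorphism L -> R[i]}) (t : 'I_nk -> {rmorphism k -> R[i]}).
Hypotheses (sP : full_embeddings s) (tP : full_embeddings t).

Lemma restriction_index : exists pi : 'I_nl -> 'I_nk,
  forall i (a : k), s i (a%:A : l) = t (pi i) a.
Proof.
have [_ t_full _] := tP.
have /boolp.choice[pi piP] : forall i, exists j,
    ((s i : {rmorphism l -> R[i]}) \o in_alg l : k -> R[i]) =1 t j.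
  by move=> i; apply: (t_full _).
by exists pi => i a; rewrite -piP.
Qed.

Variable pi : 'I_nl -> 'I_nk.
Hypothesis piP : forall i (a : k), s i (a%:A : l) = t (pi i) a.

(** The embeddings of [l] that extend [t a] are those of [complete_embeddings] over [k]; [h] locates
    them among the absolute embeddings [s]. *)
Lemma fiber_embeddings a : exists h : 'I_e -> 'I_nl,
  [/\ injective h, forall i, (i \in h @: [set: 'I_e]%SET) = (pi i == a)
    & forall x : l, t a (field_norm x) = \prod_j s (h j) x].
Proof.
have [s_inj s_full _] := sP; have [t_inj _ _] := tP.
have [r [r_base r_inj r_full r_unit]] := complete_embeddings l (t a).
have /boolp.choice[h hP] : forall j, exists i, (r j : {rmorphism L -> R[i]}) =1 s i.
  by move=> j; apply: s_full.
exists h; split.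
- by move=> j j' E; apply: r_inj => x; rewrite (hP j x) (hP j' x) E.
- move=> i; apply/imsetP/eqP => [[j _ ->]|pi_i].
    by apply: t_inj => x; rewrite -piP -hP r_base.
  have [|j rj] := r_full (s i : {rmorphism l -> R[i]}).
    by move=> x; rewrite -pi_i -piP.
  exists j; first by rewrite inE.
  by apply: s_inj => x; rewrite -hP -rj.
- move=> x; rewrite (det_embeddings x r_base r_unit).
  by apply: eq_bigr => j _; rewrite -hP.
Qed.

Lemma norm_fiber a (x : l) : t a (field_norm x) = \prod_(i | pi i == a) s i x.
Proof.
have [h [h_inj h_im ->]] := fiber_embeddings a.
under [RHS]eq_bigl => i do rewrite -h_im.
by rewrite big_imset /=; [apply: eq_bigl => j; rewrite inE | move=> j j' _ _ /h_inj].
Qed.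

Lemma card_fiber a : #|[pred i | pi i == a]| = e.
Proof.
have [h [h_inj h_im _]] := fiber_embeddings a.
rewrite -[RHS]card_ord -cardsT -(card_imset _ h_inj).
by apply: eq_card => i; rewrite h_im inE.
Qed.

Let a0 : 'I_nk := Ordinal (dim_field_gt0 k).

Lemma field_norm1 : field_norm (1 : l) = 1.
Proof.
apply: (fmorph_inj (t a0)); rewrite norm_fiber rmorph1 big1 // => i _.
exact: rmorph1.
Qed.

Lemma field_normM (x y : l) : field_norm (x * y) = field_norm x * field_norm y.
Proof.
apply: (fmorph_inj (t a0)); rewrite rmorphM !norm_fiber -big_split.
by apply: eq_bigr => i _; exact: rmorphM.
Qed.

(** Right multiplication by this matrix sums over the embeddings above each embedding of [k]: it is
    the norm to [k] read on logarithms. *)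
Definition fiber_mx : 'M[R]_(nl, nk) := \matrix_(i, a) (pi i == a)%:R.

Lemma mul_fiber_mx (v : 'rV[R]_nl) a : (v *m fiber_mx) 0 a = \sum_(i | pi i == a) v 0 i.
Proof.
rewrite mxE [RHS]big_mkcond; apply: eq_bigr => i _; rewrite mxE.
by case: ifP => _; rewrite ?mulr1 ?mulr0.
Qed.

Lemma logvec_norm (x : l) : x != 0 ->
  logvec s x *m fiber_mx = logvec t (field_norm x).
Proof.
move=> x0; apply/rowP => a; rewrite mul_fiber_mx mxE norm_fiber cabs_prod ln_prod.
  by apply: eq_bigr => i _; rewrite mxE.
by move=> i; apply: embedding_cabs_gt0.
Qed.

Lemma logvec_base (x : k) :
  logvec s (x%:A : l) *m fiber_mx = e%:R *: logvec t x.
Proof.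
apply/rowP => a; rewrite mul_fiber_mx !mxE.
rewrite (eq_bigr (fun=> ln (cabs (t a x)))) => [|i /eqP <-]; last by rewrite mxE piP.
by rewrite sumr_const card_fiber mulr_natl.
Qed.

Lemma fiber_mx_sum (v : 'rV[R]_nl) : v *m fiber_mx = 0 -> \sum_i v 0 i = 0.
Proof.
move=> v0; rewrite (partition_big pi predT) //= big1 // => a _.
by have /rowP/(_ a) := v0; rewrite mul_fiber_mx mxE.
Qed.

Lemma logvec_torsion (z : k) : torsion_units k z -> logvec t z = 0.
Proof.
move=> [[z0 _ _] [m m_gt0 zm]]; apply/rowP => a; rewrite !mxE.
have /eqP : cabs (t a z) ^+ m = 1 by rewrite -cabsX -rmorphXn zm rmorph1 cabs1.
by rewrite pexpr_eq1 ?cabs_ge0 // => /eqP->; rewrite ln1.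
Qed.

Lemma base_unit (x : k) : integer_units k x -> integer_units L (x%:A : l).
Proof.
move=> [x0 xI xVI]; have a0n : (x%:A : l) != 0 by rewrite (fmorph_eq0 (in_alg l)).
split=> //; first exact/(intring_morph (in_alg l)).
rewrite -[_^-1](fmorphV (in_alg l) x); exact/(intring_morph (in_alg l)).
Qed.

(* The units [ul] of [l] span all conjugation-invariant vectors of sum zero; the
   kernel of the fiber sum on their span has dimension at most
   [unit_rank l - unit_rank k]. *)
Lemma relative_units_span (eps : 'I_(relative_rank k l) -> l) (v : 'rV[R]_nl) c :
    (forall j, integer_units l (eps j)) ->
    (forall j, torsion_units k (field_norm (eps j))) ->
    mult_independent eps ->
    (forall i x, s (c i) x = conjc (s i x)) ->
    (forall i, v 0 (c i) = v 0 i) -> v *m fiber_mx = 0 ->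
  (v <= logmx s eps)%MS.
Proof.
move=> epsU epsN ind_eps cP v_conj v0.
have [ul [ulU ul_free ul_span]] := unit_rank_basis sP.
have [uk [ukU uk_free _]] := unit_rank_basis tP.
have [b [b_int _ b_free]] := integral_basis sP.
have v_ul : (v <= logmx s ul)%MS.
  by apply: (log_units_span sP cP b_int b_free) => //; apply: fiber_mx_sum.
have span_mx m (u : 'I_m -> L) : (forall j, integer_units L (u j)) ->
    (logmx s u <= logmx s ul)%MS.
  by move=> uU; apply/row_subP => j; rewrite rowK; apply: ul_span.
have E_free : row_free (logmx s (eps : _ -> L)).
  exact: (mult_independent_row_free sP epsU ind_eps).
have E_sub : (logmx s (eps : _ -> L) <= logmx s ul :&: kermx fiber_mx)%MS.
  rewrite sub_capmx (span_mx _ _ epsU) /=; apply/sub_kermxP/row_matrixP => j.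
  rewrite row_mul rowK row0 logvec_norm; last by case: (epsU j).
  by rewrite logvec_torsion.
(* Independent units of [k], seen in [l], have fiber sums [e] times their logarithms over [k], which
   are linearly independent. *)
have rank_k : (unit_rank k <= \rank (logmx s ul *m fiber_mx))%N.
  pose P := logmx s (fun j => (uk j)%:A : L).
  have P_sub : (P <= logmx s ul)%MS by apply: span_mx => j; apply: base_unit.
  have <- : \rank (P *m fiber_mx) = unit_rank k.
    have -> : P *m fiber_mx = e%:R *: logmx t uk.
      apply/row_matrixP => j; rewrite row_mul rowK linearZ /= rowK.
      exact: logvec_base.
    rewrite mxrank_scale_nz ?(eqP (uk_free : _ == _)) //.
    by rewrite pnatr_eq0 -lt0n adim_gt0.
  exact/mxrankS/submxMr.
(* Rank-nullity for the fiber sum on the span of the units of [l]. *)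
have rank_cap : (\rank (logmx s ul :&: kermx fiber_mx)%MS <= relative_rank k l)%N.
  have arith (x y z w : nat) : (x + y = z -> w <= x -> y <= z - w)%N.
    by move=> <- wx; rewrite leq_subRL ?leq_add2r // (leq_trans wx) // leq_addr.
  apply: arith rank_k; rewrite mxrank_mul_ker; exact/eqP.
(* The logarithms of the [eps j] lie in this kernel and already have rank [relative_rank k l], so
   they span it. *)
have [_ eq_rank] := mxrank_leqif_sup E_sub.
have : (logmx s ul :&: kermx fiber_mx <= logmx s (eps : _ -> L))%MS.
  rewrite -eq_rank eqn_leq mxrankS //=.
  by rewrite (eqP (E_free : _ == _)).
by apply: submx_trans; rewrite sub_capmx v_ul; apply/sub_kermxP.
Qed.

End RelativeNorm.

(** * Height estimate for rounded coordinates *)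

Section RealBound.
Variable R : realType.

Lemma max0E (x : R) : Num.max 0 x = (x + `|x|) / 2.
Proof. by rewrite maxr_absE sub0r normrN add0r. Qed.

(** Positive parts are subadditive, and for a vector of sum zero they add up to half the l1 norm.
    Passing to the l1 norm and back to positive parts costs nothing, so the factor 1/2 is the bound
    on the [d j]. *)
Lemma log_plus_bound n r (a : R) (y : 'I_n -> R) (d : 'I_r -> R) (E : 'I_r -> 'I_n -> R) :
    0 <= a -> (forall j, `|d j| <= 2^-1) -> (forall j, \sum_i E j i = 0) ->
  \sum_i Num.max 0 (a * y i + \sum_j d j * E j i) <=
    2^-1 * (\sum_j \sum_i Num.max 0 (E j i)) + a * \sum_i Num.max 0 (y i).
Proof.
move=> a0 dP E0; pose z i := \sum_j d j * E j i.
apply: (@le_trans _ _ (\sum_i Num.max 0 (z i) + \sum_i a * Num.max 0 (y i))).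
  rewrite -big_split; apply: ler_sum => i _ /=; rewrite maxr_pMr // mulr0 -/(z i).
  rewrite ge_max; apply/andP; split; first by rewrite addr_ge0 // le_max lexx.
  by rewrite addrC lerD // le_max lexx orbT.
rewrite -mulr_sumr lerD2r.
have sum_max (f : 'I_n -> R) : \sum_i f i = 0 ->
    \sum_i Num.max 0 (f i) = 2^-1 * \sum_i `|f i|.
  move=> f0; transitivity (2^-1 * (\sum_i f i) + 2^-1 * \sum_i `|f i|).
    rewrite !mulr_sumr -big_split; apply: eq_bigr => i _ /=.
    by rewrite max0E; field.
  by rewrite f0 mulr0 add0r.
rewrite sum_max; last first.
  rewrite exchange_big big1 //= => j _.
  by rewrite -mulr_sumr E0 mulr0.
rewrite ler_wpM2l // ?invr_ge0 //.
apply: (@le_trans _ _ (\sum_i \sum_j 2^-1 * `|E j i|)).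
  apply: ler_sum => i _; rewrite (le_trans (ler_norm_sum _ _ _)) //.
  by apply: ler_sum => j _; rewrite normrM ler_wpM2r.
rewrite exchange_big; apply: ler_sum => j _ /=.
by rewrite sum_max // mulr_sumr.
Qed.

End RealBound.

(** * The relative units form a group *)

Section CoefficientRing.
Variables (k : fieldExtType rat) (l : fieldExtType k) (n : nat) (omega : n.-tuple l).
Local Notation M := (integral_span omega).

Lemma integral_spanD x y : M x -> M y -> M (x + y).
Proof.
move=> [nu nuI ->] [nu' nu'I ->]; exists (fun i => nu i + nu' i).
  by move=> i; apply: intringD.
by rewrite -big_split; apply: eq_bigr => i _; rewrite /= scalerDl.
Qed.

Lemma integral_span0 : M 0.
Proof.
exists (fun=> 0); first by move=> _; exact: intring0.
by rewrite big1 // => i _; rewrite scale0r.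
Qed.

Lemma integral_spanZ (m : int) x : M x -> M (m%:~R * x).
Proof.
move=> [nu nuI ->]; exists (fun i => m%:~R * nu i).
  by move=> i; apply: intringM => //; apply: intring_int.
rewrite mulr_sumr; apply: eq_bigr => i _.
rewrite -scalerA -[RHS]mulr_algl; congr (_ * _).
by rewrite -[RHS]/(in_alg l _) rmorph_int.
Qed.

Lemma coefficient_ringX a i : coefficient_ring M a -> coefficient_ring M (a ^+ i).
Proof.
move=> aM; elim: i => [|i IHi] x xM; first by rewrite expr0 mul1r.
by rewrite exprS -mulrA; apply/aM/IHi.
Qed.

(* [a^-1] is integral, hence a polynomial in [a] with integer coefficients. *)
Lemma coefficient_ringV a : coefficient_units M a -> coefficient_ring M a^-1.
Proof.
move=> [aM [a0 _ [p mon_p rp]]] x xM.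
have [m Dm] : exists m, size p = m.+2.
  have pn0 : map_poly (intr : int -> l) p != 0 by rewrite monic_neq0 // monic_map.
  have := root_size_gt1 pn0 rp; have := size_poly (size p) (fun i => (p`_i)%:~R : l).
  rewrite -/(map_poly _ _) => le_sz /leq_trans/(_ le_sz).
  by case: (size p) => [|[|m]] // _; exists m.
(* The monic equation of [a^-1], of degree [m+1], multiplied by [a^m] and solved for its leading
   term. *)
have pE : a^-1 = - \sum_(i < m.+1) (p`_i)%:~R * a ^+ (m - i).
  have sz_p : (size (map_poly (intr : int -> l) p) <= m.+2)%N.
    by rewrite -Dm size_poly.
  have := rp; rewrite /root (horner_coef_wide _ sz_p) big_ord_recr /= coef_map /=.
  rewrite -[p`_m.+1]/(p`_(m.+2.-1)) -Dm -/(lead_coef p) (eqP mon_p) mul1r => /eqP E.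
  apply/eqP; rewrite -addr_eq0 addrC; apply/eqP.
  have aX : a ^+ m != 0 by rewrite expf_neq0.
  have := congr1 ( *%R (a ^+ m)) E; rewrite mulr0 mulrDr mulr_sumr.
  rewrite exprS mulrCA exprVn mulfV // mulr1 => E'; rewrite -[RHS]E'; congr (_ + _).
  apply: eq_bigr => i _; rewrite coef_map /= mulrCA; congr (_ * _).
  have le_im : (i <= m)%N by rewrite -ltnS.
  have -> : a ^+ m = a ^+ (m - i) * a ^+ i by rewrite -exprD subnK.
  by rewrite exprVn mulfK // expf_neq0.
rewrite pE mulNr mulr_suml -sumrN; elim/big_ind: _ => //.
- exact: integral_span0.
- exact: integral_spanD.
move=> i _; rewrite -mulrA -mulNr -mulrNz; apply: integral_spanZ.
by apply: coefficient_ringX.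
Qed.

End CoefficientRing.

Section TorsionUnits.
Variable F : fieldType.

Lemma torsion1 : torsion_units F 1.
Proof. by split; [exact: units1 | exists 1%N]. Qed.

Lemma torsionM x y : torsion_units F x -> torsion_units F y -> torsion_units F (x * y).
Proof.
move=> [xU [m m0 xm]] [yU [m' m'0 ym]]; split; first exact: unitsM.
exists (m * m')%N; first by rewrite muln_gt0 m0.
by rewrite exprMn exprM xm expr1n mulnC exprM ym expr1n mulr1.
Qed.

Lemma torsionV x : torsion_units F x -> torsion_units F x^-1.
Proof.
move=> [xU [m m0 xm]]; split; first exact: unitsV.
by exists m => //; rewrite exprVn xm invr1.
Qed.

End TorsionUnits.

Section RelativeUnitsGroup.
Variables (k : fieldExtType rat) (l : fieldExtType k).
Variables (n : nat) (omega : n.-tuple l).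
Local Notation M := (integral_span omega).

Hypothesis norm1 : field_norm (1 : l) = 1.
Hypothesis normM : forall x y : l, field_norm (x * y) = field_norm x * field_norm y.

Lemma relative_units1 : relative_units M 1.
Proof.
split; last by rewrite norm1; apply: torsion1.
by split; [move=> x; rewrite mul1r | exact: units1].
Qed.

Lemma relative_unitsM x y :
  relative_units M x -> relative_units M y -> relative_units M (x * y).
Proof.
move=> [[xM xU] xN] [[yM yU] yN]; split; last by rewrite normM; apply: torsionM.
by split; [move=> z zM; rewrite -mulrA; apply/xM/yM | exact: unitsM].
Qed.

Lemma relative_unitsV x : relative_units M x -> relative_units M x^-1.
Proof.
move=> [[xM xU] xN]; split.
  by split; [exact: coefficient_ringV | exact: unitsV].
have -> : field_norm x^-1 = (field_norm x)^-1; last exact: torsionV.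
have x0 : x != 0 by case: xU.
have xN0 : field_norm x != 0 by case: xN => -[].
by apply: (mulfI xN0); rewrite -normM !mulfV.
Qed.

Lemma relative_unitsXz x (z : int) : relative_units M x -> relative_units M (x ^ z).
Proof.
move=> xU; have xX i : relative_units M (x ^+ i).
  by elim: i => [|i IHi]; [exact: relative_units1 |];
     rewrite exprS; apply: relative_unitsM.
case: z => i; first exact: xX.
by rewrite NegzE -exprnN; apply/relative_unitsV/xX.
Qed.

End RelativeUnitsGroup.

(** * Rounding and the choice of the relative unit *)

Lemma round_half (R : realType) (x : R) : exists m : int, `|x - m%:~R| <= 2^-1.
Proof.
exists (Num.floor (x + 2^-1)); have := floor_itv (x + 2^-1).
by rewrite intrD ler_norml => /andP[lo hi]; apply/andP; split; lra.
Qed.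

Theorem theorem1p1 (R : realType) (k : fieldExtType rat) (l : fieldExtType k)
  (omega : (\dim (@fullv k l)).-tuple l)
  (omega_basis : basis_of (@fullv k l) omega)
  (M_integral : integral_span omega `<=` ring_of_integers l)
  (rank_gt0 : (0 < relative_rank k l)%N)
  (eps : 'I_(relative_rank k l) -> l)
  (eps_relative : forall j, relative_units (integral_span omega) (eps j))
  (eps_independent : mult_independent eps)
  (beta : k) (beta_neq0 : beta != 0) (beta_int : ring_of_integers k beta)
  (mu : l) (mu_neq0 : mu != 0) (mu_M : integral_span omega mu)
  (norm_mu : exists2 zeta : k,
     torsion_units k zeta & field_norm mu = zeta * beta) :
  exists gamma : l,
    [/\ relative_units (integral_span omega) gamma,
        integral_span omega (gamma * mu),
        exists2 zeta' : k,
          torsion_units k zeta' & field_norm (gamma * mu) = zeta' * beta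
      & (heightl R (gamma * mu) <=
           (2^-1)%:E * (\sum_j heightl R (eps j)) +
           ((\dim (@fullv k l))%:R^-1)%:E * heightl R (beta%:A : l))%E].
Proof.
have [s sP] := full_embeddings_exist R (baseFieldType l).
have [t tP] := full_embeddings_exist R k.
have [pi piP] := restriction_index s tP.
have [c cP] := conj_index sP.
have [zeta zetaT norm_mu_eq] := norm_mu.
have normM := field_normM sP tP piP; have norm1 := field_norm1 sP tP piP.
have epsU j : integer_units l (eps j) by case: (eps_relative j) => -[].
have epsN j : torsion_units k (field_norm (eps j)) by case: (eps_relative j).
have epsI j : ring_of_integers l (eps j) by case: (epsU j).
have eps0 j : eps j != 0 by case: (epsU j).
set e := \dim (@fullv k l).
have e_gt0 : (0 : R) < e%:R by rewrite ltr0n adim_gt0.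
have betaA0 : (beta%:A : l) != 0 by rewrite (fmorph_eq0 (in_alg l)).
(* The logarithm of [beta] is spread evenly over the [e] embeddings above each embedding of [k]. The
   fiber sums then cancel: those of [mu] give its norm, equal to [beta] up to torsion, and those of
   [beta] carry a factor [e]. *)
pose v : 'rV[R]_(\dim {:baseFieldType l}) :=
  logvec s mu - e%:R^-1 *: logvec s (beta%:A : l).
have v_conj i : v 0 (c i) = v 0 i.
  by rewrite !mxE !cP !cabs_conj.
have v0 : v *m fiber_mx R pi = 0.
  rewrite mulmxBl -scalemxAl (logvec_norm sP tP piP) // (logvec_base sP tP piP).
  rewrite scalerA mulVf ?lt0r_neq0 // scale1r norm_mu_eq logvecM //; last first.
    by case: zetaT => -[].
  by rewrite logvec_torsion // add0r subrr.
have /submxP[D Dv] :=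
  relative_units_span sP tP piP epsU epsN eps_independent cP v_conj v0.
have /boolp.choice[m mP] := fun j => round_half (D 0 j).
pose gamma := \prod_j eps j ^ (- m j).
have gammaR : relative_units (integral_span omega) gamma.
  rewrite /gamma; elim/big_ind: _ => [|x y|j _].
  - exact: relative_units1.
  - exact: relative_unitsM.
  - exact: relative_unitsXz.
have gamma_mu : integral_span omega (gamma * mu) by case: gammaR => -[+ _] _; apply.
have gamma0 : gamma != 0 by case: gammaR => -[_ []].
exists gamma; split=> //.
  exists (field_norm gamma * zeta); last by rewrite normM norm_mu_eq mulrA.
  by apply: torsionM => //; case: gammaR.
have height_eps j := height_integer sP (eps0 j) (epsI j).
rewrite /heightl (eq_bigr _ (fun j _ => height_eps j)).
rewrite (height_integer sP (mulf_neq0 gamma0 mu_neq0)); last exact: M_integral.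
rewrite (height_integer sP betaA0); last exact/(intring_morph (in_alg l)).
rewrite sumEFin -!EFinM -EFinD lee_fin -mulr_sumr.
(* All heights carry the same factor, the inverse of the absolute degree of [l], which is cancelled
   here. *)
rewrite [2^-1 * _]mulrCA [e%:R^-1 * _]mulrCA -mulrDr ler_wpM2l ?invr_ge0 //.
(* Since [gamma] has exponents [- m j], the coordinates [D 0 j] of [v] are replaced by their
   rounding errors. *)
have lnE i : ln (cabs (s i (gamma * mu))) = e%:R^-1 * ln (cabs (s i (beta%:A : l))) +
    \sum_j (D 0 j - (m j)%:~R) * ln (cabs (s i (eps j))).
  have E : logvec s (gamma * mu) = e%:R^-1 *: logvec s (beta%:A : l) +
      \sum_j (D 0 j - (m j)%:~R) *: logvec s (eps j).
    rewrite logvecM // logvec_prod //.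
    have -> : logvec s mu = e%:R^-1 *: logvec s (beta%:A : l) + v.
      by rewrite /v addrC subrK.
    rewrite Dv mul_logmx addrCA -big_split; congr (_ + _); apply: eq_bigr => j _.
    by rewrite /= mulrNz scaleNr scalerBl addrC.
  have /rowP/(_ i) := E; rewrite !mxE summxE => ->; congr (_ + _).
  by apply: eq_bigr => j _; rewrite !mxE.
under eq_bigr => i _ do rewrite lnE.
apply: log_plus_bound => //.
by move=> j; apply: (sum_ln_unit sP); apply: epsU.
Qed.
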